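(* Let $X$ be a Riemann surface obtained from a decorated equilateral triangulation, with associated Belyi function $f:X\to2\Delta$. Let $\omega_0=m+n\omega$ with $m,n\in\mathbb{Z}$, $\gcd(m,n)=1$ and $n$ odd, $\ell(t)=\frac12+t\omega_0$, and let $\gamma$ be the smooth closed geodesic of $2\Delta$ given by $\pi(\ell(t))$ (with $t\in[0,1]$ if $\omega_0\in Hex$, $t\in[0,3]$ if $\omega_0\notin Hex$). Let $a_i$ be an edge of the dessin of $X$ with midpoint $p_i$, and let $\Psi$ be the development of $\ell$ in $X$ with respect to $p_i$. Then the geodesic $\tilde\gamma(t)=\Psi(\ell(t))$ is smooth and closed and has length $\operatorname{length}\tilde\gamma=\operatorname{ord}\sigma_{a_i}\cdot\operatorname{length}\gamma$, where $\sigma_{a_i}$ is the cycle of $\sigma_\gamma$ which contains $a_i$. Hence $$\operatorname{length}\tilde\gamma=\begin{cases}\operatorname{ord}\sigma_{a_i}\,|\omega_0|, & \omega_0\in Hex,\\ 3\operatorname{ord}\sigma_{a_i}\,|\omega_0|, & \omega_0\notin Hex.\end{cases}$$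
   Context: Let $\omega=\exp(2\pi i/6)$, $\Lambda_{1,\omega}=\mathbb{Z}+\mathbb{Z}\omega$. $\Delta$ is the Euclidean equilateral triangle with vertices $0,1,\omega$, decorated $\circ,\bullet,\ast$ respectively; $2\Delta$ is the sphere obtained by gluing $\Delta$ and its complex conjugate $\bar\Delta$ along their boundaries via $z\mapsto\bar z$, with its flat conic metric and induced complex structure. $\Gamma_{3,3,3}$ is the group generated by the rotations of angle $2\pi/3$ about $0,1,\omega$; $2\Delta=\mathbb{C}/\Gamma_{3,3,3}$ with projection $\pi:\mathbb{C}\to2\Delta$. The tessellation of $\mathbb{C}$ by unit equilateral triangles with vertices $\Lambda_{1,\omega}$ is decorated $\Gamma_{3,3,3}$-invariantly; $Hex=\langle 2-\omega,1+\omega\rangle$ is the sub-lattice of vertices decorated $\circ$. A decorated equilateral triangulation of a compact connected oriented surface $X$ is a triangulation by Euclidean equilateral triangles of the same size, glued along edges by isometries (two triangles may share more than one edge), whose vertices are decorated by $\circ,\bullet,\ast$ so that adjacent vertices have different decorations; it induces a conic flat metric and a Riemann surface structure on $X$. Edges have length one. A triangle is black if the ordered triple $(\circ,\bullet,\ast)$ of its vertices is positively oriented and white otherwise. The associated Belyi function $f:X\to2\Delta$ sends each triangle of $X$ isometrically onto the triangle of $2\Delta$ of the same color, preserving decorations. The edges of the dessin are the edges of the triangulation joining $\circ$ to $\bullet$, and $f^{-1}(1/2)$ is the set of their midpoints. For a loop $\gamma$ in $2\Delta\setminus\{0,1,\omega\}$ based at $1/2$, $\sigma_\gamma$ is the permutation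 of $f^{-1}(1/2)$ (equivalently of the edges of the dessin) sending $x$ to the endpoint of the lift of $\gamma$ by $f$ starting at $x$; $\operatorname{ord}$ of a cycle is its length. If a line $\ell$ through $1/2$ contains no point of $\Lambda_{1,\omega}$, let $P$ be the union of the triangles of the tessellation meeting $\ell$. The development of $\ell$ in $X$ with respect to $p\in f^{-1}(1/2)$ is the unique continuous map $\Psi:P\to X$ with $\Psi(1/2)=p$ that maps triangles isometrically onto triangles, preserving decorations. The length of the closed geodesic $\tilde\gamma$ means its length over one (primitive) period of $t\mapsto\Psi(\ell(t))$.
   Formalization: The development Ψ is additionally required to send each triangle of the tessellation to a triangle of the same color (preserving orientation); otherwise Ψ could fold along edges, would not be unique, and the claim would fail. *)

(* Defs.v *)
(* MathComp-Analysis; the Euclidean plane is R[i], for R : realType. *)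
From HB Require Import structures.
From mathcomp Require Import all_boot all_order all_algebra.
From mathcomp Require Import perm.
From mathcomp Require Import all_classical all_reals all_analysis.
From mathcomp.real_closed Require Import complex.
From mathcomp Require Import ring lra.

Set Implicit Arguments.
Unset Strict Implicit.
Unset Printing Implicit Defensive.

Import Order.TTheory GRing.Theory Num.Theory.
Import numFieldNormedType.Exports.

Local Open Scope classical_set_scope.
Local Open Scope quotient_scope.
Local Open Scope ring_scope.
Local Open Scope complex_scope.

(* [normr] on R[i] takes its values in R[i]; this modulus is real-valued. *)
Notation modulus := ComplexField.Normc.normc.

(* The decorations: circ, bullet, star. *)
Definition deco := 'I_3.
Definition circ : deco := @Ordinal 3 0 isT.
Definition bullet : deco := @Ordinal 3 1 isT.
Definition star : deco := @Ordinal 3 2 isT.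

Section PlaneGeometry.
Variable R : realType.
Implicit Types (z : R[i]) (v w : deco -> R[i]).

(* exp (2 pi i / 6) *)
Definition omega : R[i] := cos (2 * pi / 6) +i* sin (2 * pi / 6).

Definition weights (b : deco -> R) := (forall k, 0 <= b k) /\ \sum_k b k = 1.

Definition barycenter v (b : deco -> R) : R[i] := \sum_k (b k)%:C * v k.

(* A decorated triangle is given by its vertices v k, k being the decoration
   of the vertex v k. *)
Definition solid v : set R[i] :=
  [set z | exists2 b, weights b & z = barycenter v b].

Definition unit_equilateral v := forall i j, i != j -> modulus (v i - v j) = 1.

(* The triple (circ, bullet, star) of vertices is positively oriented. *)
Definition positive v : bool :=
  0 < complex.Im ((v bullet - v circ)^*%C * (v star - v circ)).

Definition deco_isometry v w (h : R[i] -> R[i]) :=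
  [/\ forall z z', solid v z -> solid v z' ->
        modulus (h z - h z') = modulus (z - z'),
      h @` solid v = solid w
    & forall k, h (v k) = w k].

End PlaneGeometry.

Arguments omega {R}.

(* By distinctness of the decorations of adjacent vertices, each triangle has
   exactly one vertex of each decoration, so that its sides are named by the
   decoration of the opposite vertex, and a gluing respecting decorations
   identifies sides of the same name.  Each triangle lies in the oriented plane,
   with its orientation; the gluing is compatible with the orientations if and
   only if, after unfolding, the two triangles lie on both sides of their common
   edge, that is, if and only if they have opposite colors. *)
Record decorated_triangulation (R : realType) := DecoratedTriangulation {
  triangle : finType;
  vertex : triangle -> deco -> R[i];
  vertex_equilateral : forall t, unit_equilateral (vertex t);
  glue : deco -> triangle -> triangle;
  glueK : forall k, involutive (glue k);
  glue_oriented :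
    forall k t, positive (vertex (glue k t)) = ~~ positive (vertex t);
  triangulation_connected :
    forall s t, connect (fun t1 t2 => [exists k, t2 == glue k t1]) s t
}.

Arguments vertex {R d}.
Arguments glue {R d}.

Section Surface.
Variables (R : realType) (X : decorated_triangulation R).

Definition black (t : triangle X) : bool := positive (vertex t).

(* The disjoint union of the closed triangles. *)
Definition in_triangle (p : triangle X * R[i]) : bool :=
  `[< solid (vertex p.1) p.2 >].
Definition tri_point := {p : triangle X * R[i] | in_triangle p}.

(* Side k of t is glued to side k of [glue k t] by the isometry which respects
   the decorations of the endpoints. *)
Definition glue_step (p q : tri_point) : Prop :=
  exists k (b : deco -> R),
    [/\ weights b, b k = 0, (val q).1 = glue k (val p).1,
        (val p).2 = barycenter (vertex (val p).1) b
      & (val q).2 = barycenter (vertex (val q).1) b].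

Inductive glued : tri_point -> tri_point -> Prop :=
| glued_refl p : glued p p
| glued_step p q r : glue_step p q -> glued q r -> glued p r.

Definition gluedb (p q : tri_point) : bool := `[< glued p q >].

Lemma glue_step_sym p q : glue_step p q -> glue_step q p.
Proof.
move=> [k [b [hb bk pq hp hq]]]; exists k, b; split=> //.
by rewrite pq glueK.
Qed.

Lemma glued_trans p q r : glued p q -> glued q r -> glued p r.
Proof.
elim=> // {}p q' q'' st _ IH qr.
exact: glued_step st (IH qr).
Qed.

Lemma glued_sym p q : glued p q -> glued q p.
Proof.
elim=> [{}p|{}p q' r st _ IH]; first exact: glued_refl.
apply: glued_trans IH _.
exact: glued_step (glue_step_sym st) (glued_refl _).
Qed.

Lemma gluedb_refl : reflexive gluedb.
Proof. by move=> p; apply/asboolP; exact: glued_refl. Qed.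

Lemma gluedb_sym : symmetric gluedb.
Proof. by move=> p q; apply/asboolP/asboolP; exact: glued_sym. Qed.

Lemma gluedb_trans : transitive gluedb.
Proof.
by move=> q p r /asboolP pq /asboolP qr; apply/asboolP; exact: glued_trans qr.
Qed.

Canonical gluedb_equiv := EquivRel gluedb gluedb_refl gluedb_sym gluedb_trans.

(* The compact oriented surface obtained from the triangulation. *)
Definition surface : Type := {eq_quot gluedb_equiv}.
HB.instance Definition _ := Choice.on surface.

Lemma in_triangle_vertex (t : triangle X) : in_triangle (t, vertex t circ).
Proof.
apply/asboolP; exists (fun k => (k == circ)%:R).
  split=> [k|]; first exact: ler0n.
  by rewrite (bigD1 circ) //= ?eqxx big1 ?addr0 // => i /negPf ->.
rewrite /barycenter (bigD1 circ) //= ?eqxx mul1r big1 ?addr0 // => i /negPf ->.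
by rewrite mul0r.
Qed.

(* The point of the surface represented by the point z of the triangle t (an
   unspecified point of t when z is not in t). *)
Definition pt (t : triangle X) (z : R[i]) : surface :=
  \pi_{eq_quot gluedb_equiv}
    (insubd (Sub (t, vertex t circ) (in_triangle_vertex t) : tri_point) (t, z)).

(* Chains of Euclidean segments, each of them inside one triangle, together with
   their total length. *)
Inductive chain : surface -> surface -> R -> Prop :=
| chain_nil x : chain x x 0
| chain_cons t z w y r :
    solid (vertex t) z -> solid (vertex t) w -> chain (pt t w) y r ->
    chain (pt t z) y (modulus (z - w) + r).

(* The distance of the flat conic metric. *)
Definition dist (x y : surface) : R := inf [set r | chain x y r].

(* This is dist x y < e, since X is connected. *)
Definition surface_ball (x : surface) (e : R) : set surface :=
  [set y | exists2 r, chain x y r & r < e].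

Lemma chain_trans x y z r s : chain x y r -> chain y z s -> chain x z (r + s).
Proof.
elim=> [{}x|t u w {}y {}r ut wt _ IH] yz; first by rewrite add0r.
by rewrite -addrA; apply: chain_cons => //; exact: IH.
Qed.

Lemma chain_sym x y r : chain x y r -> chain y x r.
Proof.
elim=> [{}x|t u w {}y {}r ut wt _ IH]; first exact: chain_nil.
rewrite addrC; apply: chain_trans IH _.
rewrite -[X in chain _ _ X]addr0 -normcN opprB.
by apply: chain_cons => //; exact: chain_nil.
Qed.

Lemma surface_ball_center x (e : R) : 0 < e -> surface_ball x e x.
Proof. by move=> e0; exists 0 => //; exact: chain_nil. Qed.

Lemma surface_ball_sym x y (e : R) : surface_ball x e y -> surface_ball y e x.
Proof. by move=> [r xy re]; exists r => //; exact: chain_sym. Qed.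

Lemma surface_ball_triangle x y z (e1 e2 : R) :
  surface_ball x e1 y -> surface_ball y e2 z -> surface_ball x (e1 + e2) z.
Proof.
move=> [r xy re] [s yz se]; exists (r + s); first exact: chain_trans yz.
exact: ltrD.
Qed.

HB.instance Definition _ :=
  hasNbhs.Build surface (nbhs_ (entourage_ surface_ball)).
HB.instance Definition _ := @Nbhs_isPseudoMetric.Build R surface
  (entourage_ surface_ball) erefl surface_ball surface_ball_center
  surface_ball_sym surface_ball_triangle erefl.

(* An edge of the dessin is represented by the two triangles which it bounds;
   it is their common side opposite to the vertices decorated star. *)
Definition is_dessin_edge (e : {set triangle X}) : bool :=
  [exists t, e == [set t; glue star t]%SET].
Definition dessin_edge := {e : {set triangle X} | is_dessin_edge e}.

Definition midpoint (e : dessin_edge) : surface :=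
  let t := xchoose (existsP (valP e)) in
  pt t ((vertex t circ + vertex t bullet) / 2).

(* The length of a path is the supremum of the lengths of the inscribed
   polygons. *)
Definition path_length (c : R -> surface) (a b : R) : \bar R :=
  ereal_sup [set (\sum_(0 <= i < size s)
      dist (c (nth b (a :: s) i)) (c (nth b (a :: s) i.+1)))%:E
    | s in itv_partition a b].

(* phi is a flat chart of X centered at x: an isometry from the Euclidean disk
   of radius r about 0 onto the ball of radius r about x.  There is none if x is
   a conic point. *)
Definition flat_chart (x : surface) (r : R) (phi : R[i] -> surface) :=
  [/\ 0 < r, phi 0 = x,
      forall z w, modulus z < r -> modulus w < r ->
        dist (phi z) (phi w) = modulus (z - w)
    & phi @` [set z | modulus z < r] = ball x r].

(* In flat charts, c is a straight line run through at constant nonzero speed;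
   in particular c avoids the conic points. *)
Definition smooth_geodesic (c : R -> surface) :=
  forall t0, exists r phi u,
    [/\ flat_chart (c t0) r phi, u != 0
      & \forall t \near t0, c t = phi ((t - t0)%:C * u)].

Definition is_period (c : R -> surface) (T : R) :=
  0 < T /\ forall t, c (t + T) = c t.

Definition primitive_period (c : R -> surface) (T : R) :=
  is_period c T /\ forall T', is_period c T' -> T <= T'.

End Surface.

Arguments pt {R X}.


Section Sphere.
Variable R : realType.

Definition delta_vertex (k : deco) : R[i] := nth 0 [:: 0; 1; omega] k.

(* The vertices of Delta (true) and of its complex conjugate (false). *)
Definition double_vertex (c : bool) (k : deco) : R[i] :=
  if c then delta_vertex k else (delta_vertex k)^*%C.

Lemma sin_pi3_gt0 : 0 < sin (2 * pi / 6) :> R.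
Proof.
have pi0 := pi_gt0 R.
by apply: sin_gt0_pi; apply/andP; split; lra.
Qed.

Lemma cos_pi3 : cos (2 * pi / 6) = 1 / 2 :> R.
Proof.
set x : R := 2 * pi / 6.
have s0 := sin_pi3_gt0; rewrite -/x in s0.
have h : sin (x + x) = sin x.
  have -> : x + x = pi - x by rewrite /x; field.
  by rewrite sinB sinpi cospi; ring.
rewrite sinD in h.
have : sin x * (2 * cos x - 1) = 0 by move: h; lra.
move=> /eqP; rewrite mulf_eq0 (gt_eqF s0) /= => /eqP; lra.
Qed.

Lemma modulus_double c i j :
  modulus (double_vertex c i - double_vertex c j) =
  modulus (delta_vertex i - delta_vertex j).
Proof.
rewrite /double_vertex; case: c => //; rewrite -rmorphB /=.
by case: (delta_vertex i - delta_vertex j) => a b /=; rewrite sqrrN.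
Qed.

Lemma double_equilateral c : unit_equilateral (double_vertex c).
Proof.
have e : cos (2 * pi / 6) ^+ 2 + sin (2 * pi / 6) ^+ 2 = 1 :> R.
  exact: cos2Dsin2.
have h1 : modulus (1 : R[i]) = 1 by rewrite ComplexField.Normc.normc1.
have h2 : modulus (@omega R) = 1 by rewrite /= e sqrtr1.
have h3 : modulus (1 - @omega R) = 1.
  rewrite /= -[RHS]sqrtr1; congr Num.sqrt.
  have := cos_pi3; move: e; set x := cos _; set y := sin _ => e hx.
  have -> : (1 - x) ^+ 2 + (0 - y) ^+ 2 = 1 - 2 * x + (x ^+ 2 + y ^+ 2).
    by ring.
  by rewrite e hx; field.
move=> i j ij; rewrite modulus_double.
wlog lt_ij : i j ij / (i < j)%N.
  move=> H; case: (ltngtP i j) => [|lt|eq]; first exact: H.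
    by rewrite -normcN opprB; apply: H; rewrite // eq_sym.
  by move: ij; rewrite (val_inj eq) eqxx.
have nB (x y : R[i]) : modulus (x - y) = modulus (y - x).
  by rewrite -normcN opprB.
case: i j ij lt_ij => [[|[|[|//]]] ?] [[|[|[|//]]] ?] // _ _.
- by rewrite nB -[LHS]/(modulus (1 - 0)) subr0.
- by rewrite nB -[LHS]/(modulus (omega - 0)) subr0.
Qed.

Lemma double_oriented (k : deco) c :
  positive (double_vertex (~~ c)) = ~~ positive (double_vertex c).
Proof.
have s0 := sin_pi3_gt0.
have ht : positive (double_vertex true).
  rewrite /positive /double_vertex /delta_vertex /=; lra.
have hf : positive (double_vertex false) = false.
  rewrite /positive /double_vertex /delta_vertex /=.
  by apply/negbTE; rewrite -leNgt; lra.
by case: c; rewrite ?ht ?hf.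
Qed.

Lemma double_connected (s t : bool) :
  connect (fun t1 t2 => [exists k : deco, t2 == ~~ t1]) s t.
Proof.
case: (eqVneq s t) => [->|st]; first exact: connect0.
by apply: connect1; apply/existsP; exists circ; case: s t st => [] [].
Qed.

(* The sphere 2 Delta: the triangulation by the two triangles Delta and
   its complex conjugate, glued along their boundaries by z |-> z^*. *)
Definition doubleDelta : decorated_triangulation R :=
  @DecoratedTriangulation R bool double_vertex double_equilateral
    (fun _ => negb) (fun _ => negbK) double_oriented double_connected.

Definition sphere := surface doubleDelta.

Definition rotation (c z : R[i]) : R[i] := c + omega ^+ 2 * (z - c).

(* The group Gamma_{3,3,3}; inverses are obtained as squares. *)
Inductive Gamma333 : (R[i] -> R[i]) -> Prop :=
| Gamma_id : Gamma333 id
| Gamma_rotation k : Gamma333 (rotation (delta_vertex k))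
| Gamma_comp g h : Gamma333 g -> Gamma333 h -> Gamma333 (g \o h).

(* The projection pi from C onto C / Gamma_{3,3,3} = 2 Delta, for which Delta
   and its conjugate form together a fundamental domain. *)
Definition projection (z : R[i]) : sphere :=
  xget (pt (true : triangle doubleDelta) 0)
    [set x | exists2 g, Gamma333 g &
       exists c : triangle doubleDelta,
         solid (vertex c) (g z) /\ x = pt c (g z)].

Definition lattice : set R[i] :=
  [set z | exists a b : int, z = a%:~R + b%:~R * omega].

Definition Hex : set R[i] :=
  [set z | exists a b : int, z = a%:~R * (2 - omega) + b%:~R * (1 + omega)].

(* The invariant decoration of the lattice under Gamma_{3,3,3}. *)
Definition decorated (z : R[i]) (k : deco) :=
  exists2 g, Gamma333 g & g (delta_vertex k) = z.

(* The triangles of the tessellation of the plane. *)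
Definition tile (v : deco -> R[i]) :=
  unit_equilateral v /\ forall k, lattice (v k) /\ decorated (v k) k.

(* The union of the triangles of the tessellation meeting the line l. *)
Definition strip (l : R -> R[i]) : set R[i] :=
  [set z | exists v, [/\ tile v, solid v z & exists t, solid v (l t)]].

Variable X : decorated_triangulation R.

(* f sends each triangle of X isometrically onto the triangle of 2 Delta of the
   same color, preserving decorations. *)
Definition belyi_function (f : surface X -> sphere) :=
  forall t : triangle X, exists (c : triangle doubleDelta) (h : R[i] -> R[i]),
    [/\ black c = black t, deco_isometry (vertex t) (vertex c) h
      & forall z, solid (vertex t) z -> f (pt t z) = pt c (h z)].

(* The development of l in X with respect to p.  Without preservation of the
   colors (equivalently of the orientation) it would not be unique, as Psi could
   be folded along the edge containing 1/2. *)
Definition development (l : R -> R[i]) (p : surface X)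
    (Psi : R[i] -> surface X) :=
  [/\ {within (strip l : set R[i]^o), continuous (Psi : R[i]^o -> surface X)},
      Psi (1 / 2) = p
    & forall v, tile v -> (exists t, solid v (l t)) ->
        exists (t : triangle X) (h : R[i] -> R[i]),
          [/\ black t = positive v, deco_isometry v (vertex t) h
            & forall z, solid v z -> Psi z = pt t (h z)]].

Definition is_lift (f : surface X -> sphere) (gamma : R -> sphere) (tau : R)
    (x : surface X) (c : R -> surface X) :=
  [/\ {within `[0, tau], continuous c}, c 0 = x
    & forall t, t \in `[0, tau] -> f (c t) = gamma t].

(* sigma is the permutation sigma_gamma, for the loop gamma on [0, tau]. *)
Definition monodromy (f : surface X -> sphere) (gamma : R -> sphere) (tau : R)
    (sigma : {perm dessin_edge X}) :=
  forall e, exists2 c, is_lift f gamma tau (midpoint e) c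
                     & c tau = midpoint (sigma e).

End Sphere.

(* Main.v *)
(* Both [Psi o l] and [gamma] are unfolded paths: near every time, the union of
   two adjacent triangles of the surface unfolds isometrically onto a rhombus of
   the plane, in which the path is straight.  Following a chain of segments
   through the rhombus shows that it carries a flat chart; hence both paths are
   smooth and their length is proportional to the time.  The Belyi function
   preserves barycentric weights and colors, so it is locally injective away from
   the vertices, and [Psi o l] is the unique lift of [gamma].  Thus, after k turns
   of [gamma], [Psi o l] reaches the midpoint of the edge [sigma^k a], and
   [#|porbit sigma a| * tau] is a period.  Conversely, if T is a period then
   [projection (l (t + T)) = projection (l t)] for all t, so that a translation of
   Gamma_{3,3,3} maps l(t) to l(t + T), which forces [T omega0] to be in Hex and T
   to be a multiple of [tau]. *)

Require Import Defs.
From HB Require Import structures.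
From mathcomp Require Import all_boot all_order all_algebra.
From mathcomp Require Import perm.
From mathcomp Require Import all_classical all_reals all_analysis.
From mathcomp.real_closed Require Import complex.
From mathcomp Require Import ring lra zify.

Set Implicit Arguments.
Unset Strict Implicit.
Unset Printing Implicit Defensive.

Import Order.TTheory GRing.Theory Num.Theory.
Import numFieldNormedType.Exports.

Local Open Scope classical_set_scope.
Local Open Scope ring_scope.
Local Open Scope complex_scope.

Local Notation glue := Defs.glue.

(** Everything is computed in barycentric weights indexed by the decorations. Gluing, the Belyi
    function, the development and the projection keep the weights and change only the triangle, and
    the distance between two points of a unit equilateral triangle depends on their weights alone. A
    point of a surface is thus given by a triangle and weights, and its triangle is known up to one
    gluing as soon as at most one weight vanishes. The obstacle is the vertices, where more than two
    triangles may meet, a flat chart may not exist and the Belyi function may ramify. The parity of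
    [n] keeps the line away from them, so two triangles always suffice. Orientability enters as the
    rule that neighbours have opposite colors: it prevents a rhombus from being folded onto one
    triangle. Local facts are made global by induction along real time instead of a subdivision of
    the interval. In the plane, the decoration of a lattice point is a residue modulo 3, and the
    statements about [Gamma333] become integer arithmetic. *)

Section Deco.

Lemma deco_ind (P : deco -> Prop) :
  P circ -> P bullet -> P star -> forall k, P k.
Proof.
move=> p0 p1 p2 [[|[|[|//]]] i].
- by rewrite (_ : Ordinal i = circ) //; apply: val_inj.
- by rewrite (_ : Ordinal i = bullet) //; apply: val_inj.
- by rewrite (_ : Ordinal i = star) //; apply: val_inj.
Qed.

Lemma sum_deco (V : nmodType) (F : deco -> V) :
  \sum_k F k = F circ + F bullet + F star.
Proof.
rewrite !big_ord_recl big_ord0 addr0 addrA.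
by congr (F _ + F _ + F _); apply: val_inj.
Qed.

End Deco.

(** * Real coordinates and the modulus *)

Section Modulus.
Variable R : realType.
Implicit Types z w : R[i].

Lemma complex_ext z w : complex.Re z = complex.Re w -> complex.Im z = complex.Im w -> z = w.
Proof. by case: z w => [a b] [c d] /= -> ->. Qed.

Lemma ReD z w : complex.Re (z + w) = complex.Re z + complex.Re w.
Proof. by case: z w => [a b] [c d]. Qed.
Lemma ImD z w : complex.Im (z + w) = complex.Im z + complex.Im w.
Proof. by case: z w => [a b] [c d]. Qed.
Lemma ReN z : complex.Re (- z) = - complex.Re z.
Proof. by case: z. Qed.
Lemma ImN z : complex.Im (- z) = - complex.Im z.
Proof. by case: z. Qed.
Lemma ReM z w : complex.Re (z * w) = complex.Re z * complex.Re w - complex.Im z * complex.Im w.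
Proof. by case: z w => [a b] [c d]. Qed.
Lemma ImM z w : complex.Im (z * w) = complex.Re z * complex.Im w + complex.Im z * complex.Re w.
Proof. by case: z w => [a b] [c d]. Qed.
Lemma ReMn z n : complex.Re (z *+ n) = complex.Re z *+ n.
Proof. by elim: n => [|n IH]; rewrite ?mulr0n // !mulrS ReD IH. Qed.
Lemma ImMn z n : complex.Im (z *+ n) = complex.Im z *+ n.
Proof. by elim: n => [|n IH]; rewrite ?mulr0n // !mulrS ImD IH. Qed.
Lemma ReMz z n : complex.Re (z *~ n) = complex.Re z *~ n.
Proof. by case: n => n; rewrite /intmul ?ReN ReMn. Qed.
Lemma ImMz z n : complex.Im (z *~ n) = complex.Im z *~ n.
Proof. by case: n => n; rewrite /intmul ?ImN ImMn. Qed.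
Lemma Re1 : complex.Re (1 : R[i]) = 1. Proof. by []. Qed.
Lemma Im1 : complex.Im (1 : R[i]) = 0. Proof. by []. Qed.
Lemma Re0 : complex.Re (0 : R[i]) = 0. Proof. by []. Qed.
Lemma Im0 : complex.Im (0 : R[i]) = 0. Proof. by []. Qed.
Lemma ReC (a : R) : complex.Re (a%:C) = a. Proof. by []. Qed.
Lemma ImC (a : R) : complex.Im (a%:C) = 0. Proof. by []. Qed.
Definition ReImE := (ReD, ImD, ReN, ImN, ReM, ImM, ReMn, ImMn, ReMz, ImMz,
  Re1, Im1, Re0, Im0, ReC, ImC).

Lemma sqr_modulus z : modulus z ^+ 2 = complex.Re z ^+ 2 + complex.Im z ^+ 2.
Proof. by case: z => a b /=; rewrite sqr_sqrtr // addr_ge0 ?sqr_ge0. Qed.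

Lemma modulus_ge0 z : 0 <= modulus z.
Proof. by case: z => a b; exact: sqrtr_ge0. Qed.

Lemma modulusE z : (modulus z)%:C = `|z|.
Proof. by case: z. Qed.

Lemma modulusD z w : modulus (z + w) <= modulus z + modulus w.
Proof.
have := ler_normD z w; rewrite -!modulusE -rmorphD /=.
by rewrite lecE /= => /andP[].
Qed.

Lemma modulusN z : modulus (- z) = modulus z.
Proof. by case: z => a b /=; rewrite !sqrrN. Qed.

Lemma modulusB z w : modulus (z - w) = modulus (w - z).
Proof. by rewrite -modulusN opprB. Qed.

Lemma modulus_triangle a z w : modulus (z - w) <= modulus (z - a) + modulus (a - w).
Proof. by rewrite -[z - w](subrKA a); exact: modulusD. Qed.

Lemma modulus0 : modulus (0 : R[i]) = 0.
Proof. exact: ComplexField.Normc.normc0. Qed.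

Lemma modulus0_eq0 z : modulus z = 0 -> z = 0.
Proof. exact: ComplexField.Normc.eq0_normc. Qed.

Lemma modulusM z w : modulus (z * w) = modulus z * modulus w.
Proof. exact: ComplexField.Normc.normcM. Qed.

Lemma modulus_real (a : R) : modulus (a%:C) = `|a|.
Proof. by rewrite /= expr0n /= addr0 sqrtr_sqr. Qed.

End Modulus.

(** * The metric of a unit equilateral triangle in terms of weights *)

Section Barycenter.
Variable R : realType.
Implicit Types (v w : deco -> R[i]) (b d : deco -> R) (z : R[i]).

Lemma ReBary v b : complex.Re (barycenter v b) = \sum_k b k * complex.Re (v k).
Proof. by rewrite /barycenter !sum_deco !ReImE !mul0r !subr0. Qed.
Lemma ImBary v b : complex.Im (barycenter v b) = \sum_k b k * complex.Im (v k).
Proof. by rewrite /barycenter !sum_deco !ReImE !mul0r !addr0. Qed.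

Lemma eq_barycenter v w b d :
  (forall k, b k = d k) -> (forall k, b k = 0 \/ v k = w k) -> barycenter v b = barycenter w d.
Proof.
move=> bd h; apply: eq_bigr => k _; rewrite -bd.
by case: (h k) => ->; rewrite ?mul0r.
Qed.

Lemma barycenter_comb v b d (s t : R) :
  barycenter v (fun k => s * b k + t * d k) =
  s%:C * barycenter v b + t%:C * barycenter v d.
Proof.
by apply: complex_ext; rewrite !ReImE !(ReBary, ImBary) !sum_deco; ring.
Qed.

Lemma barycenterB v b d :
  barycenter v (fun k => b k - d k) = barycenter v b - barycenter v d.
Proof.
by apply: complex_ext; rewrite !ReImE !(ReBary, ImBary) !sum_deco; ring.
Qed.

Lemma edge_sqr v i j : unit_equilateral v -> i != j ->
  (complex.Re (v i) - complex.Re (v j)) ^+ 2 + (complex.Im (v i) - complex.Im (v j)) ^+ 2 = 1.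
Proof.
by move=> ev /ev; move/(congr1 (fun x => x ^+ 2)); rewrite sqr_modulus !ReImE expr1n.
Qed.

(** For total weight 0 the squared norm is minus the sum over pairs of [d i * d j] times the squared
    side, which is 1. Hence all unit equilateral triangles induce the same metric on weights. *)
Lemma sqr_modulus_barycenter v d : unit_equilateral v -> \sum_k d k = 0 ->
  modulus (barycenter v d) ^+ 2 = (\sum_k d k ^+ 2) / 2.
Proof.
move=> ev; rewrite sqr_modulus ReBary ImBary !sum_deco => d0.
have h1 : _ = _ := edge_sqr (i := circ) (j := bullet) ev isT.
have h2 : _ = _ := edge_sqr (i := circ) (j := star) ev isT.
have h3 : _ = _ := edge_sqr (i := bullet) (j := star) ev isT.
have -> : d circ = - d bullet - d star by lra.
(* Each factor 1 stands for the square of an edge. *)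
transitivity (d bullet * (d bullet + d star) * 1 +
  d star * (d bullet + d star) * 1 - d bullet * d star * 1 : R).
  by rewrite -{1}h1 -{1}h2 -h3; ring.
by field.
Qed.

Lemma modulus_barycenterB v b d : unit_equilateral v -> \sum_k b k = \sum_k d k ->
  modulus (barycenter v b - barycenter v d) ^+ 2 = (\sum_k (b k - d k) ^+ 2) / 2.
Proof.
move=> ev h; rewrite -barycenterB sqr_modulus_barycenter //.
by rewrite big_split /= sumrN h subrr.
Qed.

Lemma modulus_barycenter_eq v w b d :
  unit_equilateral v -> unit_equilateral w -> \sum_k b k = \sum_k d k ->
  modulus (barycenter v b - barycenter v d) = modulus (barycenter w b - barycenter w d).
Proof.
move=> ev ew h; apply/eqP; rewrite -(@eqrXn2 _ 2) ?modulus_ge0 //.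
by rewrite !modulus_barycenterB.
Qed.

(** A single square is at most twice the squared distance; the constant 2 rounds up the square root
    of 2. This turns closeness in the plane into closeness of weights. *)
Lemma coordinate_lipschitz v b d : unit_equilateral v -> \sum_k b k = \sum_k d k ->
  forall k, `|b k - d k| <= 2 * modulus (barycenter v b - barycenter v d).
Proof.
move=> ev h k; rewrite -(@ler_pXn2r _ 2) ?nnegrE ?mulr_ge0 ?modulus_ge0 //.
rewrite exprMn modulus_barycenterB // real_normK ?num_real //.
have : 0 <= \sum_(j | j != k) (b j - d j) ^+ 2 by apply: sumr_ge0 => j _; exact: sqr_ge0.
have := sqr_ge0 (b k - d k); rewrite [\sum_j _](bigD1 k) //=.
set x := \sum_(_ | _) _; set y := (_ - _) ^+ 2; lra.
Qed.

Lemma barycenter_inj v b d : unit_equilateral v -> \sum_k b k = \sum_k d k ->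
  barycenter v b = barycenter v d -> b = d.
Proof.
move=> ev h e; apply/funext => k; apply/eqP; rewrite -subr_eq0 -normr_le0.
by have := coordinate_lipschitz ev h k; rewrite e subrr modulus0 mulr0.
Qed.

Lemma barycenter_surj v z : unit_equilateral v ->
  exists2 b, \sum_k b k = 1 & z = barycenter v b.
Proof.
move=> ev.
have h1 : _ = _ := edge_sqr (i := circ) (j := bullet) ev isT.
have h2 : _ = _ := edge_sqr (i := circ) (j := star) ev isT.
have h3 : _ = _ := edge_sqr (i := bullet) (j := star) ev isT.
pose x1 := complex.Re (v bullet) - complex.Re (v circ).
pose y1 := complex.Im (v bullet) - complex.Im (v circ).
pose x2 := complex.Re (v star) - complex.Re (v circ).
pose y2 := complex.Im (v star) - complex.Im (v circ).
have e1 : x1 ^+ 2 + y1 ^+ 2 = 1 by rewrite -h1 /x1 /y1; ring.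
have e2 : x2 ^+ 2 + y2 ^+ 2 = 1 by rewrite -h2 /x2 /y2; ring.
have e3 : x1 * x2 + y1 * y2 = 1 / 2.
  have : (x1 - x2) ^+ 2 + (y1 - y2) ^+ 2 = 1 by rewrite -h3 /x1 /y1 /x2 /y2; ring.
  move: e1 e2; lra.
(* The determinant in Cramer's rule; its square comes from Lagrange's identity. *)
pose D := x1 * y2 - x2 * y1.
have D2 : D ^+ 2 = 3 / 4.
  have -> : D ^+ 2 = (x1 ^+ 2 + y1 ^+ 2) * (x2 ^+ 2 + y2 ^+ 2) - (x1 * x2 + y1 * y2) ^+ 2.
    by rewrite /D; ring.
  by rewrite e1 e2 e3; field.
have D0 : D != 0 by apply/eqP => D0; move: D2; rewrite D0; lra.
pose X := complex.Re z - complex.Re (v circ); pose Y := complex.Im z - complex.Im (v circ).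
pose s := (X * y2 - x2 * Y) / D; pose t := (x1 * Y - X * y1) / D.
exists (fun k => if k == circ then 1 - s - t else if k == bullet then s else t).
  by rewrite sum_deco /=; ring.
have eX : X = s * x1 + t * x2 by rewrite /s /t /D; field.
have eY : Y = s * y1 + t * y2 by rewrite /s /t /D; field.
apply: complex_ext; rewrite !(ReBary, ImBary) !sum_deco /=.
  have -> : complex.Re z = X + complex.Re (v circ) by rewrite /X; ring.
  by rewrite eX /x1 /x2; ring.
have -> : complex.Im z = Y + complex.Im (v circ) by rewrite /Y; ring.
by rewrite eY /y1 /y2; ring.
Qed.

Definition vertex_weights (k : deco) : deco -> R := fun j => (j == k)%:R.

Lemma sum_vertex_weights k : \sum_j vertex_weights k j = 1.
Proof. by rewrite /vertex_weights sum_deco; elim/deco_ind: k => /=; ring. Qed.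

Lemma weights_vertex k : weights (vertex_weights k).
Proof. by split=> [j|]; rewrite ?sum_vertex_weights ?ler0n. Qed.

Lemma barycenter_vertex v k : barycenter v (vertex_weights k) = v k.
Proof.
rewrite /barycenter (bigD1 k) //= /vertex_weights eqxx mul1r big1 ?addr0 //.
by move=> i /negPf ->; rewrite mul0r.
Qed.

Lemma solid_barycenter v b : weights b -> solid v (barycenter v b).
Proof. by exists b. Qed.

(* The squared distances to the vertices determine the weights. *)
Lemma deco_isometryE v w h : unit_equilateral v -> unit_equilateral w ->
  deco_isometry v w h -> forall b, weights b -> h (barycenter v b) = barycenter w b.
Proof.
move=> ev ew [hi hs hv] b wb.
have : solid w (h (barycenter v b)) 
  by rewrite -hs; exists (barycenter v b) => //; exact: solid_barycenter.
case=> d wd hd.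
suff bd : b = d by rewrite hd bd.
have key k : (\sum_j (b j - vertex_weights k j) ^+ 2) / 2 =
    (\sum_j (d j - vertex_weights k j) ^+ 2) / 2.
  rewrite -(modulus_barycenterB ev) -1?(modulus_barycenterB ew); last 2 first.
  - by rewrite sum_vertex_weights (proj2 wd).
  - by rewrite sum_vertex_weights (proj2 wb).
  rewrite !barycenter_vertex -hi ?hv ?hd //; first exact: solid_barycenter.
  by rewrite -(barycenter_vertex v k); apply/solid_barycenter/weights_vertex.
have := key circ; have := key bullet; have := key star.
case: wb wd => _ + [_].
rewrite !sum_deco /vertex_weights /= => b1 d1 k1 k2 k3.
by apply/funext; elim/deco_ind; lra.
Qed.

End Barycenter.

(** * Equality of points of the surface *)

Section Points.
Variables (R : realType) (X : decorated_triangulation R).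
Implicit Types (t : triangle X) (b : deco -> R) (p q : tri_point X).

Definition wpt t b : surface X := pt t (barycenter (vertex t) b).

Lemma glue_neq k t : glue k t != t.
Proof. by apply/eqP => e; have := glue_oriented k t; rewrite e; case: positive. Qed.

(** Crossing side [j] requires a zero weight at [j]. If only the weight of [k] may vanish, every
    step crosses side [k], and since [glue k] is an involution only two triangles are reachable. *)
Lemma glued_weights p q : glued p q -> forall b, weights b ->
  (val p).2 = barycenter (vertex (val p).1) b ->
  (val q).2 = barycenter (vertex (val q).1) b /\
  forall k, (forall j, j != k -> b j != 0) ->
    (val q).1 = (val p).1 \/ b k = 0 /\ (val q).1 = glue k (val p).1.
Proof.
elim=> [{}p|{}p q1 {}q [k [d [wd dk q1E pd q1d]]] _ IH] b wb pb.
  by split=> // k _; left.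
have bd : b = d.
  apply: (barycenter_inj (vertex_equilateral (val p).1)); last by rewrite -pb.
  by rewrite (proj2 wb) (proj2 wd).
rewrite -bd in q1d dk; have [qb hq] := IH b wb q1d.
split=> // j hj; have jk : j = k.
  by apply/eqP; apply: contraT; rewrite eq_sym => /hj; rewrite dk eqxx.
subst j; case: (hq k hj) => [|[_]]; rewrite q1E ?glueK; first by right.
by left.
Qed.

Lemma insubd_pt t b : weights b -> forall p0 : tri_point X,
  val (insubd p0 (t, barycenter (vertex t) b)) = (t, barycenter (vertex t) b).
Proof. by move=> wb p0; rewrite val_insubd ifT //; apply/asboolP; exists b. Qed.

Lemma wpt_eqP t t' b b' : weights b -> weights b' -> wpt t b = wpt t' b' ->
  b = b' /\ forall k, (forall j, j != k -> b j != 0) ->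
    t' = t \/ b k = 0 /\ t' = glue k t.
Proof.
move=> wb wb'; rewrite /wpt /pt.
set p := insubd _ _; set q := insubd _ _ => /eqmodP/asboolP/glued_weights h.
have pE : val p = (t, barycenter (vertex t) b) by exact: insubd_pt.
have qE : val q = (t', barycenter (vertex t') b') by exact: insubd_pt.
case: (h b wb); rewrite pE ?qE //= => e hk; split=> //.
apply: (barycenter_inj (vertex_equilateral t')) => //.
by rewrite (proj2 wb) (proj2 wb').
Qed.

Lemma wpt_glue k t b : weights b -> b k = 0 -> wpt (glue k t) b = wpt t b.
Proof.
move=> wb bk; rewrite /wpt /pt; set q := insubd _ _; set p := insubd _ _.
have pE : val p = (t, barycenter (vertex t) b) by exact: insubd_pt.
have qE : val q = (glue k t, barycenter (vertex (glue k t)) b) by exact: insubd_pt.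
apply/eqmodP/asboolP; apply: (@glued_step _ _ _ p); last exact: glued_refl.
by exists k, b; rewrite pE qE /= glueK.
Qed.

End Points.

(** * Reflection of a triangle in one of its sides *)

Section Reflection.
Variable R : realType.
Implicit Types (v : deco -> R[i]) (b d : deco -> R) (k : deco).

(** The mirror image of a vertex of an equilateral triangle is the fourth corner of a parallelogram:
    the sum of the two other vertices minus that vertex. *)
Definition vrefl k v : deco -> R[i] :=
  fun j => if j == k then \sum_i v i - v k *+ 2 else v j.

(** The change of weights between a triangle and its mirror image. The sign of the weight of [k]
    tells on which side of the common line a point lies. *)
Definition wrefl k b : deco -> R := fun j => if j == k then - b k else b j + b k.

Lemma barycenter_vrefl k v b : barycenter (vrefl k v) b = barycenter v (wrefl k b).
Proof.
by apply: complex_ext; rewrite !(ReBary, ImBary) !sum_deco /vrefl /wrefl !sum_deco;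
  elim/deco_ind: k => /=; rewrite !ReImE; ring.
Qed.

Lemma sum_wrefl k b : \sum_j wrefl k b j = \sum_j b j.
Proof. by rewrite !sum_deco /wrefl; elim/deco_ind: k => /=; ring. Qed.

Lemma wreflK k : involutive (wrefl k).
Proof.
move=> b; apply/funext => j; rewrite /wrefl eqxx.
by case: (eqVneq j k) => [->|_]; ring.
Qed.

Lemma vreflK k : involutive (vrefl k).
Proof.
move=> v; apply/funext => j.
by rewrite -barycenter_vertex !barycenter_vrefl wreflK barycenter_vertex.
Qed.

Lemma vrefl_equilateral k v : unit_equilateral v -> unit_equilateral (vrefl k v).
Proof.
move=> ev i j ij; apply/eqP; rewrite -(@eqrXn2 _ 2) ?modulus_ge0 // expr1n.
rewrite -(barycenter_vertex (vrefl k v) i) -(barycenter_vertex (vrefl k v) j).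
rewrite !barycenter_vrefl modulus_barycenterB //; last by rewrite !sum_wrefl !sum_vertex_weights.
rewrite sum_deco /wrefl /vertex_weights.
by apply/eqP; move: ij; elim/deco_ind: k; elim/deco_ind: i; elim/deco_ind: j => //= _; field.
Qed.

Lemma wrefl_eq0 k b : b k = 0 -> wrefl k b = b.
Proof.
move=> bk; apply/funext => j; rewrite /wrefl; case: ifP => [/eqP ->|_].
  by rewrite bk oppr0.
by rewrite bk addr0.
Qed.

Lemma lower_bound k b : (forall j, j != k -> 0 < b j) ->
  exists2 e, 0 < e & forall j, j != k -> e <= b j.
Proof.
have gen (x y : R) : 0 < x -> 0 < y -> exists2 e, 0 < e & e <= x /\ e <= y.
  move=> x0 y0; exists (Num.min x y); first by rewrite lt_min x0.
  by rewrite !ge_min !lexx orbT.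
elim/deco_ind: k => h.
- have [e e0 [e1 e2]] := gen _ _ (h bullet isT) (h star isT).
  by exists e => //; elim/deco_ind.
- have [e e0 [e1 e2]] := gen _ _ (h circ isT) (h star isT).
  by exists e => //; elim/deco_ind.
- have [e e0 [e1 e2]] := gen _ _ (h circ isT) (h bullet isT).
  by exists e => //; elim/deco_ind.
Qed.

End Reflection.

(** * The rhombus of two adjacent triangles as a flat chart *)

Section Chain.
Variables (R : realType) (X : decorated_triangulation R).

Lemma chain_ge0 (x y : surface X) l : chain x y l -> 0 <= l.
Proof. by elim=> // *; rewrite addr_ge0 // modulus_ge0. Qed.

End Chain.

Section Chart.
Variables (R : realType) (X : decorated_triangulation R).
Variables (v : deco -> R[i]) (t : triangle X) (k : deco).
Hypothesis ev : unit_equilateral v.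
Implicit Types (b d : deco -> R) (z w : R[i]) (s : bool).

Definition half s := if s then vrefl k v else v.
Definition half_triangle s := if s then glue k t else t.

Lemma half_equilateral s : unit_equilateral (half s).
Proof. by case: s => //; exact: vrefl_equilateral. Qed.

Lemma half_negb s : half (~~ s) = vrefl k (half s).
Proof. by case: s => //=; rewrite vreflK. Qed.

Lemma half_triangle_negb s : half_triangle (~~ s) = glue k (half_triangle s).
Proof. by case: s => //=; rewrite glueK. Qed.

(** Reflection negates the weight of [k], which is nonnegative in both halves, so the halves overlap
    only along the common side. *)
Lemma half_weights s b d : weights b -> weights d ->
  barycenter (half s) b = barycenter (half (~~ s)) d -> b = d /\ b k = 0.
Proof.
move=> [b0 b1] [d0 d1]; rewrite half_negb barycenter_vrefl => e.
have bd : b = wrefl k d.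
  by apply: barycenter_inj e; [exact: half_equilateral|rewrite sum_wrefl b1 d1].
have dk : d k = 0.
  have := b0 k; have := d0 k; rewrite bd /wrefl eqxx; lra.
by rewrite bd wrefl_eq0.
Qed.

(* The rhombus formed by the triangle v and its mirror image in the side k is
   mapped onto the triangles t and glue k t of the surface. *)
Definition unfold z : surface X :=
  xget (wpt t (vertex_weights R circ))
    [set x | exists s b, [/\ weights b, z = barycenter (half s) b
                           & x = wpt (half_triangle s) b]].

(** Well-definedness: a point with representations in both halves lies on the common side, where the
    gluing identifies its two images. *)
Lemma unfoldE s b : weights b ->
  unfold (barycenter (half s) b) = wpt (half_triangle s) b.
Proof.
move=> wb; rewrite /unfold; case: xgetP => [x _ [s' [d [wd zd ->]]]|h]; last first.
  by case: (h (wpt (half_triangle s) b)); exists s, b.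
case: (eqVneq s' s) => [|ss'].
  move=> ?; subst s'; congr wpt; apply: barycenter_inj (esym zd); first exact: half_equilateral.
  by rewrite (proj2 wb) (proj2 wd).
have s'E : s' = ~~ s by case: s s' ss' {zd} => [] [].
rewrite s'E in zd *; have [bd bk] := half_weights wb wd zd.
by rewrite -bd half_triangle_negb wpt_glue.
Qed.

(** An open rhombus: it contains the inside of the common side but none of the four outer sides. *)
Definition rhombus : set R[i] :=
  [set z | exists s b, [/\ weights b, forall j, j != k -> 0 < b j
                         & z = barycenter (half s) b]].

Lemma rhombus_half z : rhombus z ->
  exists s b, weights b /\ z = barycenter (half s) b.
Proof. by case=> s [b [wb _ zb]]; exists s, b. Qed.

Lemma rhombus_open z0 : rhombus z0 ->
  exists2 r, 0 < r & forall z, modulus (z - z0) < r -> rhombus z.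
Proof.
case=> s [b0 [wb0 b0j ->]]; have [e e0 he] := lower_bound b0j.
(* Within [e / 4] each weight moves by less than [e / 2]. If [b k] becomes negative, the point is
   described in the other half, where the weight [b j + b k] is still positive. *)
exists (e / 4) => [|z zr]; first lra.
have es := half_equilateral s.
have [b b1 zb] := barycenter_surj z es.
have close j : `|b j - b0 j| <= 2 * modulus (z - barycenter (half s) b0).
  by rewrite zb; apply: coordinate_lipschitz; rewrite // b1 (proj2 wb0).
have b0k := (proj1 wb0) k.
have close' j : - (e / 2) < b j - b0 j.
  have := close j; rewrite ler_norml => /andP[h _]; lra.
have pos j : j != k -> 0 < b j by move=> /he; have := close' j; lra.
case: (leP 0 (b k)) => bk.
  exists s, b; split=> //; split=> // j.
  by case: (eqVneq j k) => [->//|/pos/ltW].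
have pos' j : j != k -> 0 < wrefl k b j.
  move=> jk; rewrite /wrefl (negbTE jk); have := he j jk; have := close' j; have := close' k; lra.
exists (~~ s), (wrefl k b); split=> //; last by rewrite half_negb barycenter_vrefl wreflK.
split; last by rewrite sum_wrefl.
move=> j; case: (eqVneq j k) => [->|/pos'/ltW//].
by rewrite /wrefl eqxx oppr_ge0 ltW.
Qed.

(** The two triangles are distinct because their colors are opposite; points of different halves
    with the same image therefore lie on the common side. *)
Lemma unfold_inj z w : rhombus z -> rhombus w -> unfold z = unfold w -> z = w.
Proof.
case=> s [b [wb bj ->]] [s' [d [wd dj ->]]]; rewrite !unfoldE //.
move=> /(wpt_eqP wb wd)[bd /(_ k) h]; rewrite -bd.
have {}h := h (fun j jk => lt0r_neq0 (bj j jk)).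
case: (eqVneq s' s) => [->//|ss'].
have s'E : s' = ~~ s by case: s s' ss' {h} => [] [].
rewrite s'E half_triangle_negb in h; rewrite s'E half_negb barycenter_vrefl.
case: h => [e|[bk _]]; last by rewrite wrefl_eq0.
by have := glue_neq k (half_triangle s); rewrite e eqxx.
Qed.

Lemma unfold_chain z w : (exists s b, weights b /\ z = barycenter (half s) b) ->
  (exists s b, weights b /\ w = barycenter (half s) b) ->
  chain (unfold z) (unfold w) (modulus (z - w)).
Proof.
have seg s b d r y : weights b -> weights d -> chain (unfold (barycenter (half s) d)) y r ->
    chain (unfold (barycenter (half s) b)) y
      (modulus (barycenter (half s) b - barycenter (half s) d) + r).
  move=> wb wd; rewrite !unfoldE // => c.
  have -> : modulus (barycenter (half s) b - barycenter (half s) d) = modulus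
      (barycenter (vertex (half_triangle s)) b - barycenter (vertex (half_triangle s)) d).
    apply: modulus_barycenter_eq; [exact: half_equilateral|exact: vertex_equilateral|].
    by rewrite (proj2 wb) (proj2 wd).
  by apply: chain_cons => //; exact: solid_barycenter.
case=> s [b [wb ->]] [s' [d [wd ->]]].
case: (eqVneq s' s) => [->|ss'].
  by rewrite -[modulus _]addr0; apply: seg => //; exact: chain_nil.
have -> : s' = ~~ s by case: s s' ss' => [] [].
have dE : barycenter (half (~~ s)) d = barycenter (half s) (wrefl k d).
  by rewrite half_negb barycenter_vrefl.
have bk := (proj1 wb) k; have dk := (proj1 wd) k.
case: (eqVneq (b k + d k) 0) => [h|h].
  rewrite dE wrefl_eq0; last lra.
  by rewrite -[modulus _]addr0; apply: seg => //; exact: chain_nil.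
have h0 : 0 < b k + d k by rewrite lt_def h addr_ge0.
(* Along the segment the weight of [k], read in the half [s], runs linearly from [b k] to [- d k];
   it vanishes at [u]. The segment is cut there, so that each piece lies in one triangle. *)
pose u := b k / (b k + d k).
have u0 : 0 <= u by rewrite divr_ge0 // ltW.
have u1 : u <= 1 by rewrite ler_pdivrMr // mul1r; lra.
pose q := fun j => (1 - u) * b j + u * wrefl k d j.
have qk : q k = 0 by rewrite /q /u /wrefl eqxx; field.
have wq : weights q.
  split=> [j|].
    case: (eqVneq j k) => [->|jk]; first by rewrite qk.
    rewrite /q /wrefl (negbTE jk) addr_ge0 // mulr_ge0 //; first lra.
      exact: (proj1 wb).
    by rewrite addr_ge0 // (proj1 wd).
  by rewrite /q big_split /= -!mulr_sumr sum_wrefl (proj2 wb) (proj2 wd); ring.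
have qE : barycenter (half s) q = barycenter (half (~~ s)) q.
  by rewrite half_negb barycenter_vrefl wrefl_eq0.
have -> : modulus (barycenter (half s) b - barycenter (half (~~ s)) d) =
    modulus (barycenter (half s) b - barycenter (half s) q) +
    (modulus (barycenter (half (~~ s)) q - barycenter (half (~~ s)) d) + 0).
  rewrite -qE dE /q barycenter_comb; set B := barycenter _ b; set D := barycenter _ _.
  have -> : B - ((1 - u)%:C * B + u%:C * D) = u%:C * (B - D).
    by rewrite rmorphB rmorph1; ring.
  have -> : (1 - u)%:C * B + u%:C * D - D = (1 - u)%:C * (B - D).
    by rewrite rmorphB rmorph1; ring.
  rewrite !modulusM !modulus_real !ger0_norm //; first ring.
  by rewrite subr_ge0.
apply: (seg s) => //; rewrite qE; apply: (seg (~~ s)) => //; exact: chain_nil.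
Qed.

(** A short chain is pulled back to the plane one segment at a time. The bound on
    [modulus (z - z0) + l] is preserved and keeps all its points inside the rhombus. *)
Lemma chain_unfold z0 r x y l : (forall z, modulus (z - z0) < r -> rhombus z) ->
  chain x y l -> forall z, modulus (z - z0) + l < r -> x = unfold z ->
  exists2 w, y = unfold w & modulus (w - z) <= l.
Proof.
move=> hr; elim=> [{}x z _ xz|t' z1 w1 {}y {}l [b1 wb1 ->] [b2 wb2 ->] c IH z zl].
  by exists z => //; rewrite subrr modulus0.
have l0 := chain_ge0 c.
set m := modulus (barycenter _ b1 - _) in zl *; have m0 : 0 <= m := modulus_ge0 _.
have [|s [b [wb bj zb]]] := hr z; first lra.
rewrite {1}zb unfoldE // => /(wpt_eqP wb1 wb)[bb1]; subst b1.
move=> /(_ k (fun j jk => lt0r_neq0 (bj j jk))) ht.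
(* A point of the common side belongs to both halves, so the half can be chosen to match the
   triangle that carries the next segment. *)
have [s' [tE zE]] : exists s', t' = half_triangle s' /\ z = barycenter (half s') b.
  case: ht => [e|[bk e]]; first by exists s.
  exists (~~ s); rewrite half_triangle_negb e glueK half_negb barycenter_vrefl.
  by rewrite wrefl_eq0.
pose w := barycenter (half s') b2.
have wz : modulus (w - z) = m.
  rewrite /m modulusB zE; apply: modulus_barycenter_eq.
  - exact: half_equilateral.
  - exact: vertex_equilateral.
  - by rewrite (proj2 wb) (proj2 wb2).
have [||w' yw' w'w] := IH w.
- by have := modulus_triangle z w z0; lra.
- by rewrite tE unfoldE.
by exists w' => //; have := modulus_triangle w w' z; lra.
Qed.

(** The factor 3: a chain shorter than [modulus (z - w)] has length below [2 * r] and starts within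
    [r] of [z0], so it cannot leave the larger disk and gain by a shortcut elsewhere. *)
Lemma dist_unfold z0 r z w : 0 < r -> (forall z, modulus (z - z0) < 3 * r -> rhombus z) ->
  modulus (z - z0) < r -> modulus (w - z0) < r ->
  dist (unfold z) (unfold w) = modulus (z - w).
Proof.
move=> r0 hr zr wr.
have rz : rhombus z by apply: hr; lra.
have rw : rhombus w by apply: hr; lra.
have cl : chain (unfold z) (unfold w) (modulus (z - w)).
  exact: unfold_chain (rhombus_half rz) (rhombus_half rw).
have lb : lbound [set l | chain (unfold z) (unfold w) l] (modulus (z - w)).
  move=> l cl'; rewrite leNgt; apply/negP => lzw.
  have zw : modulus (z - w) < 2 * r by have := modulus_triangle z0 z w; have := modulusB z0 w; lra.
  have [|w' ww' hw'] := chain_unfold hr cl' _ erefl; first lra.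
  have e : w = w'.
    apply: unfold_inj ww' => //; apply: hr; have := modulus_triangle z w' z0; lra.
  by move: lzw; rewrite e modulusB; lra.
apply/eqP; rewrite eq_le; apply/andP; split.
  by apply: ge_inf => //; exists (modulus (z - w)).
by apply: lb_le_inf => //; exists (modulus (z - w)).
Qed.

Lemma unfold_ball z0 r : 0 < r -> (forall z, modulus (z - z0) < r -> rhombus z) ->
  forall e, e <= r -> forall y, surface_ball (unfold z0) e y <->
    exists2 w, modulus (w - z0) < e & y = unfold w.
Proof.
move=> r0 hr e er y; split=> [[l c le]|[w we ->]].
  have [||w yw wl] := chain_unfold hr c (z := z0) => //.
    by rewrite subrr modulus0; lra.
  by exists w => //; lra.
exists (modulus (z0 - w)); last by rewrite modulusB.
apply: unfold_chain; apply: rhombus_half; apply: hr; last lra.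
by rewrite subrr modulus0.
Qed.

Lemma unfold_flat_chart z0 r : 0 < r -> (forall z, modulus (z - z0) < 3 * r -> rhombus z) ->
  flat_chart (unfold z0) r (fun z => unfold (z0 + z)).
Proof.
move=> r0 hr; split=> //; first by rewrite addr0.
  move=> z w zr wr; have -> : z - w = z0 + z - (z0 + w) by ring.
  by apply: (@dist_unfold z0 r) => //; rewrite addrC addKr.
have r3 : r <= 3 * r by lra.
rewrite -[ball _ _]/(surface_ball (unfold z0) r).
apply/seteqP; split=> [_ [z zr <-]|y].
  by apply/(unfold_ball _ hr r3); [lra|exists (z0 + z); rewrite // (addrC z0) addrK].
move=> /(unfold_ball _ hr r3)[|w wr ->]; first lra.
by exists (w - z0); rewrite // addrC subrK.
Qed.

End Chart.

(** * Induction along a real interval *)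

Section RealInduction.
Variable R : realType.

Lemma near_ballP (t : R) (P : R -> Prop) :
  (\forall s \near t, P s) <-> exists2 e, 0 < e & forall s, `|s - t| < e -> P s.
Proof.
split=> [/nbhs_ballP[e e0 he]|[e e0 he]].
  by exists e => // s st; apply: he; rewrite /ball /= distrC.
by apply/nbhs_ballP; exists e => // s; rewrite /ball /= distrC; exact: he.
Qed.

(** The step only has to carry [P] across each time [t]. Taken at the supremum of the times where
    [P] holds, it leads beyond the supremum unless this is already [b]. *)
Lemma real_induction (a b : R) (P : R -> Prop) : a <= b -> P a ->
  (forall t, a <= t <= b -> exists2 e, 0 < e & forall x y,
     a <= x <= b -> a <= y <= b -> `|x - t| < e -> `|y - t| < e -> x <= t <= y ->
     P x -> P y) ->
  P b.
Proof.
move=> ab Pa step; pose S := [set x | a <= x <= b /\ P x].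
have Sa : S a by rewrite /S /= lexx.
have Sb : ubound S b by move=> x [/andP[]].
have hS : has_sup S by split; [exists a|exists b].
pose s := sup S.
have as_ : a <= s by apply: ub_le_sup => //; exact: (proj2 hS).
have sb : s <= b by apply: ge_sup => //; exists a.
have [|e e0 he] := step s; first by rewrite as_ sb.
have [x Sx xs] := sup_adherent e0 hS.
have xs' : x <= s by apply: ub_le_sup => //; exact: (proj2 hS).
have {}xs : `|x - s| < e by rewrite ltr_norml; apply/andP; split; rewrite -/s in xs; lra.
have [xab Px] := Sx.
pose y := Num.min b (s + e / 2).
have sy : s <= y by rewrite /y le_min sb; lra.
have yb : y <= b by rewrite /y ge_min lexx.
have ye : y <= s + e / 2 by rewrite /y ge_min lexx orbT.
have yab : a <= y <= b by rewrite yb (le_trans as_).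
have Py : P y.
  apply: (he x) => //; last by rewrite xs' sy.
  by rewrite ger0_norm; lra.
have ys : y <= s by apply: ub_le_sup; [exact: (proj2 hS)|].
have := ys; rewrite {1}/y ge_min => /orP[bs|]; last lra.
by have -> : b = y by lra.
Qed.

End RealInduction.

(** * Paths that are straight in rhombi: smoothness and length *)

Section Paths.
Variables (R : realType) (X : decorated_triangulation R).
Implicit Types (c : R -> surface X) (u : R[i]).

(** One velocity [u] serves at all times, each rhombus being placed in the plane accordingly;
    constant speed is thus built in. *)
Definition unfolded_path c u := forall t0, exists v t k z0,
  [/\ unit_equilateral v, rhombus v k z0
    & \forall s \near t0, c s = unfold v t k (z0 + (s - t0)%:C * u)].

(* The point lies in the interior of a triangle or of an edge. *)
Definition regular (x : surface X) := exists t k b,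
  [/\ weights b, forall j, j != k -> 0 < b j & x = wpt t b].

Lemma unfold_regular v t k z : unit_equilateral v -> rhombus v k z ->
  regular (unfold (X := X) v t k z).
Proof.
move=> ev [s [b [wb bj ->]]]; rewrite unfoldE //.
by exists (half_triangle t k s), k, b.
Qed.

Lemma regular_unfold x : regular x -> exists v t k z0 r,
  [/\ unit_equilateral v, 0 < r, forall z, modulus (z - z0) < r -> rhombus v k z
    & x = unfold v t k z0].
Proof.
case=> t [k [b [wb bj ->]]].
pose v := vertex t; have ev : unit_equilateral v := vertex_equilateral t.
have hz : rhombus v k (barycenter (half v k false) b) by exists false, b.
have [r r0 hr] := rhombus_open ev hz.
by exists v, t, k, (barycenter (half v k false) b), r; split=> //; rewrite unfoldE.
Qed.

Lemma unfolded_path_regular c u t : unfolded_path c u -> regular (c t).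
Proof.
move=> /(_ t)[v [t' [k [z0 [ev hz]]]]] /nbhs_singleton ->.
by rewrite subrr mul0r addr0; exact: unfold_regular.
Qed.

Lemma unfolded_path_near c u : unfolded_path c u -> forall t0,
  exists v t k z0 r, [/\ unit_equilateral v, 0 < r,
    forall z, modulus (z - z0) < 3 * r -> rhombus v k z
    & exists2 e, 0 < e & forall s, `|s - t0| < e ->
        c s = unfold v t k (z0 + (s - t0)%:C * u) /\ modulus ((s - t0)%:C * u) < r].
Proof.
move=> h t0; have [v [t [k [z0 [ev hz]]]]] := h t0.
move=> /near_ballP[e e0 he]; have [r r0 hr] := rhombus_open ev hz.
exists v, t, k, z0, (r / 3); split=> //; first lra.
  by move=> z zr; apply: hr; lra.
have mu := modulus_ge0 u.
(* Adding 1 allows division also when [u] is 0. *)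
have m1 : 0 < modulus u + 1 by lra.
have d0 : 0 < r / 3 / (modulus u + 1) by rewrite divr_gt0 //; lra.
exists (Num.min e (r / 3 / (modulus u + 1))); first by rewrite lt_min e0.
move=> s; rewrite lt_min => /andP[se sr]; split; first exact: he.
rewrite modulusM modulus_real; rewrite ltr_pdivlMr // in sr.
by have := normr_ge0 (s - t0); set x := `|_| in sr *; nra.
Qed.

Lemma unfolded_path_smooth c u : u != 0 -> unfolded_path c u -> smooth_geodesic c.
Proof.
move=> u0 h t0; have [v [t [k [z0 [r [ev r0 hr [e e0 he]]]]]]] := unfolded_path_near h t0.
exists r, (fun z => unfold v t k (z0 + z)), u; split=> //; last first.
  by apply/near_ballP; exists e => // s /he[].
have -> : c t0 = unfold v t k z0.
  by have [] := he t0; rewrite ?subrr ?normr0 // mul0r addr0.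
exact: unfold_flat_chart.
Qed.

Lemma unfolded_path_isometry c u : unfolded_path c u -> forall t0,
  exists2 e, 0 < e & forall x y, `|x - t0| < e -> `|y - t0| < e ->
    chain (c x) (c y) (`|x - y| * modulus u) /\ dist (c x) (c y) = `|x - y| * modulus u.
Proof.
move=> h t0; have [v [t [k [z0 [r [ev r0 hr [e e0 he]]]]]]] := unfolded_path_near h t0.
exists e => // x y /he[-> xr] /he[-> yr].
set a := (x - t0)%:C * u in xr *; set b := (y - t0)%:C * u in yr *.
have -> : `|x - y| * modulus u = modulus (z0 + a - (z0 + b)).
  rewrite -modulus_real -modulusM; congr modulus.
  by rewrite /a /b !rmorphB; ring.
have ea w : z0 + w - z0 = w by rewrite addrC addKr.
split; last by apply: (dist_unfold t ev r0 hr); rewrite ea.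
apply: unfold_chain => //; apply: rhombus_half; apply: hr; rewrite ea; lra.
Qed.

(** The path need not be minimizing, so in the large it bounds the distance only from above. *)
Lemma unfolded_path_chain c u x y : unfolded_path c u -> x <= y ->
  chain (c x) (c y) ((y - x) * modulus u).
Proof.
move=> h xy; apply: (@real_induction _ x y
  (fun z => chain (c x) (c z) ((z - x) * modulus u))) => //.
  by rewrite subrr mul0r; exact: chain_nil.
move=> t0 _; have [e e0 he] := unfolded_path_isometry h t0; exists e => //.
move=> a b _ _ ha hb /andP[a0 b0] cl.
have [cl' _] := he a b ha hb.
have := chain_trans cl cl'; rewrite distrC ger0_norm; last by lra.
by have -> : (a - x) * modulus u + (b - a) * modulus u = (b - x) * modulus u by ring.
Qed.

Lemma unfolded_path_continuous c u : unfolded_path c u -> forall t e, 0 < e ->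
  exists2 d, 0 < d & forall s, `|s - t| < d -> surface_ball (c t) e (c s).
Proof.
move=> h t e e0; have [d d0 hd] := unfolded_path_isometry h t.
have mu := modulus_ge0 u; have m1 : 0 < modulus u + 1 by lra.
have e1 : 0 < e / (modulus u + 1) by rewrite divr_gt0.
exists (Num.min d (e / (modulus u + 1))); first by rewrite lt_min d0.
move=> s; rewrite lt_min => /andP[sd]; rewrite ltr_pdivlMr // => se.
have [|cl _] := hd t s _ sd; first by rewrite subrr normr0.
exists (`|t - s| * modulus u) => //; rewrite distrC.
by have := normr_ge0 (s - t); set x := `|_| in se *; nra.
Qed.

Lemma dist_le_chain (x y : surface X) l : chain x y l -> dist x y <= l.
Proof.
by move=> cl; apply: ge_inf => //; exists 0 => r; exact: chain_ge0.
Qed.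

Fixpoint polygon_length c (a : R) (s : seq R) : R :=
  if s is b :: s' then dist (c a) (c b) + polygon_length c b s' else 0.

Lemma polygon_lengthE c a s d :
  \sum_(0 <= i < size s) dist (c (nth d (a :: s) i)) (c (nth d (a :: s) i.+1)) =
  polygon_length c a s.
Proof.
elim: s a => [|b s IH] a; first by rewrite big_geq.
by rewrite /= big_nat_recl //= -IH.
Qed.

Lemma polygon_length_rcons c a s b :
  polygon_length c a (rcons s b) = polygon_length c a s + dist (c (last a s)) (c b).
Proof.
by elim: s a => [|d s IH] a /=; rewrite ?addr0 ?add0r // IH addrA.
Qed.

(** Each side of an inscribed polygon is at most the arc that it spans; a partition subordinate to
    the local isometries attains the bound. *)
Lemma unfolded_path_length c u a b : unfolded_path c u -> a <= b ->
  path_length c a b = ((b - a) * modulus u)%:E.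
Proof.
move=> h ab; apply/eqP; rewrite eq_le; apply/andP; split.
  apply: ge_ereal_sup => _ [s [sp sl] <-]; rewrite lee_fin polygon_lengthE.
  move: sl => /eqP <-; elim: s a sp {ab} => [|d s IH] a /=; first by rewrite subrr mul0r.
  move=> /andP[ad sp]; have := IH d sp.
  have := dist_le_chain (unfolded_path_chain h (ltW ad)).
  by set L := last d s; lra.
suff [s sp sl] : exists2 s, itv_partition a b s & polygon_length c a s = (b - a) * modulus u.
  by apply: ereal_sup_ubound; exists s => //; rewrite polygon_lengthE sl.
apply: (@real_induction _ a b (fun z => exists2 s, itv_partition a z s &
  polygon_length c a s = (z - a) * modulus u)) => //.
  by exists [::] => //=; rewrite subrr mul0r.
move=> t0 _; have [e e0 he] := unfolded_path_isometry h t0; exists e => //.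
move=> x y _ _ hx hy /andP[x0 y0] [s sx sl].
case: (eqVneq x y) => [<-|xy]; first by exists s.
have {}xy : x < y by rewrite lt_def eq_sym xy (le_trans x0).
case: sx => sp /eqP lx.
exists (rcons s y); first by split; rewrite ?rcons_path ?sp ?lx //= last_rcons.
have [_ d] := he x y hx hy.
rewrite polygon_length_rcons lx sl d distrC ger0_norm; last lra.
by ring.
Qed.

End Paths.

(** * Uniqueness of lifts through the Belyi function *)

Section Lifting.
Variables (R : realType) (X : decorated_triangulation R).
Implicit Types (x y : surface X).

(** The topology comes from a pseudometric, so separation needs a proof. A [y] inseparable from [x]
    lies in every ball about [x], hence is the image of some [w] other than [z0]; by injectivity the
    ball of radius [modulus (w - z0)] excludes it. *)
Lemma regular_separated x y : regular x -> x != y ->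
  exists2 e, 0 < e & forall z, surface_ball x e z -> ~ surface_ball y e z.
Proof.
move=> /regular_unfold[v [t [k [z0 [r [ev r0 hr xE]]]]]] xy; apply: contrapT => h.
suff yx e : 0 < e -> surface_ball x e y.
  have [w wr yw] : exists2 w, modulus (w - z0) < r & y = unfold v t k w.
    by apply/(unfold_ball t ev r0 hr (lexx r)); rewrite -xE; exact: yx.
  move/eqP: xy; apply; rewrite xE yw; congr unfold.
  apply/eqP; rewrite eq_sym -subr_eq0; apply: contraT => wz.
  have mwz : 0 < modulus (w - z0).
    by rewrite lt_def modulus_ge0 andbT; apply: contraNneq wz => /modulus0_eq0 ->.
  have := yx _ mwz; rewrite xE => /(unfold_ball t ev r0 hr (ltW wr))[w' ww' yw'].
  have e : w = w'.
    apply: (unfold_inj ev (t := t) (k := k)); rewrite -?yw //; apply: hr => //; lra.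
  by move: ww'; rewrite -e ltxx.
move=> e0; apply: contrapT => nyx; apply: h; exists (e / 2); first lra.
move=> z xz yz; apply: nyx; have -> : e = e / 2 + e / 2 by lra.
exact: surface_ball_triangle xz (surface_ball_sym yz).
Qed.

Variables (f : surface X -> sphere R).
Hypothesis fE : forall (t : triangle X) b, weights b ->
  f (wpt t b) = wpt (black t : triangle (doubleDelta R)) b.

(** Points with the same image have equal weights. If they lie in different halves, their triangles
    have opposite colors, so the images agree only on side [k], where the points themselves are
    glued. *)
Lemma regular_injective x : regular x ->
  exists2 e, 0 < e & forall y z, surface_ball x e y -> surface_ball x e z ->
    f y = f z -> y = z.
Proof.
move=> /regular_unfold[v [t [k [z0 [r [ev r0 hr ->]]]]]].
exists r => // y z /(unfold_ball t ev r0 hr (lexx r))[w wr ->].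
move=> /(unfold_ball t ev r0 hr (lexx r))[w' wr' ->].
have [s [b [wb bj ->]]] := hr w wr; have [s' [d [wd dj ->]]] := hr w' wr'.
rewrite !unfoldE // !fE // => /(wpt_eqP wb wd)[bd]; subst d.
move=> /(_ k (fun j jk => lt0r_neq0 (bj j jk))) h.
case: (eqVneq s' s) => [->//|ss'].
have s'E : s' = ~~ s by case: s s' ss' {h} => [] [].
rewrite s'E half_triangle_negb in h *.
case: h => [e|[bk _]]; last by rewrite wpt_glue.
have := glue_oriented k (half_triangle t k s).
by rewrite -/(black _) -/(black _) e; case: black.
Qed.

Lemma unique_lift (c c' : R -> surface X) (T : R) : 0 <= T -> c 0 = c' 0 ->
  (forall t, 0 <= t <= T -> regular (c t) /\ f (c t) = f (c' t)) ->
  (forall g, g = c \/ g = c' -> forall t e, 0 <= t <= T -> 0 < e ->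
     exists2 d, 0 < d & forall s, 0 <= s <= T -> `|s - t| < d ->
       surface_ball (g t) e (g s)) ->
  c T = c' T.
Proof.
move=> T0 c0 hreg hcont.
apply: (@real_induction _ 0 T (fun t => c t = c' t)) => // t tT.
have [rt ft] := hreg t tT.
(* Where the lifts agree, local injectivity propagates the equality; where they differ, separation
   excludes equality at any nearby time [x]. *)
case: (eqVneq (c t) (c' t)) => [e|ne].
  have [r r0 hr] := regular_injective rt.
  have [d d0 hd] := hcont c (or_introl erefl) t r tT r0.
  have [d' d'0 hd'] := hcont c' (or_intror erefl) t r tT r0.
  exists (Num.min d d'); first by rewrite lt_min d0.
  move=> x y xT yT _; rewrite lt_min => /andP[yd yd'] _ _.
  apply: hr; first exact: hd.
    by rewrite e; exact: hd'.
  by case: (hreg y yT).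
have [r r0 hr] := regular_separated rt ne.
have [d d0 hd] := hcont c (or_introl erefl) t r tT r0.
have [d' d'0 hd'] := hcont c' (or_intror erefl) t r tT r0.
exists (Num.min d d'); first by rewrite lt_min d0.
move=> x y xT yT; rewrite lt_min => /andP[xd xd'] _ _ e.
case: (hr (c x)); first exact: hd.
by rewrite e; exact: hd'.
Qed.

End Lifting.

(** * The lattice, its decoration and the group in integer coordinates *)

Section Lattice.
Variable R : realType.
Implicit Types (z w : R[i]) (a b : int).

Definition lat a b : R[i] := a%:~R + b%:~R * omega.

Definition height : R := sin (2 * pi / 6).

Lemma height_gt0 : 0 < height. Proof. exact: sin_pi3_gt0. Qed.

Lemma height_sqr : height ^+ 2 = 3 / 4.
Proof. by have := cos2Dsin2 (2 * pi / 6 : R); rewrite cos_pi3 -/height; lra. Qed.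

Lemma omegaE : omega = (1 / 2) +i* height.
Proof. by rewrite /omega cos_pi3. Qed.

Lemma Re_omega : complex.Re (@omega R) = 1 / 2. Proof. by rewrite omegaE. Qed.
Lemma Im_omega : complex.Im (@omega R) = height. Proof. by []. Qed.

Lemma omega_sqr : omega ^+ 2 = omega - 1 :> R[i].
Proof.
have := height_sqr.
by rewrite !expr2 => h; apply: complex_ext; rewrite !ReImE ?Re_omega ?cos_pi3 ?Im_omega; lra.
Qed.

(* Coordinates in the real basis (1, omega). *)
Definition ycoord z : R := complex.Im z / height.
Definition xcoord z : R := complex.Re z - ycoord z / 2.

Lemma coordE z : z = (xcoord z)%:C + (ycoord z)%:C * omega.
Proof.
have h0 := lt0r_neq0 height_gt0.
by apply: complex_ext; rewrite /xcoord /ycoord !ReImE ?Re_omega ?cos_pi3 ?Im_omega; field.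
Qed.

Lemma coord_ext z w : xcoord z = xcoord w -> ycoord z = ycoord w -> z = w.
Proof. by move=> xzw yzw; rewrite (coordE z) (coordE w) xzw yzw. Qed.

Lemma coordK (x y : R) :
  xcoord (x%:C + y%:C * omega) = x /\ ycoord (x%:C + y%:C * omega) = y.
Proof.
have h0 := lt0r_neq0 height_gt0.
by rewrite /xcoord /ycoord !ReImE ?Re_omega ?cos_pi3 ?Im_omega; split; field.
Qed.

Lemma intrC a : (a%:~R : R[i]) = (a%:~R : R)%:C.
Proof. by rewrite rmorph_int. Qed.

Lemma xcoord_lat a b : xcoord (lat a b) = a%:~R.
Proof. by rewrite /lat !intrC (coordK _ _).1. Qed.
Lemma ycoord_lat a b : ycoord (lat a b) = b%:~R.
Proof. by rewrite /lat !intrC (coordK _ _).2. Qed.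

Lemma xcoord_barycenter (v : deco -> R[i]) (b : deco -> R) :
  xcoord (barycenter v b) = \sum_k b k * xcoord (v k).
Proof. by rewrite /xcoord /ycoord ReBary ImBary !sum_deco; ring. Qed.
Lemma ycoord_barycenter (v : deco -> R[i]) (b : deco -> R) :
  ycoord (barycenter v b) = \sum_k b k * ycoord (v k).
Proof. by rewrite /ycoord ImBary !sum_deco; ring. Qed.

Lemma lat_inj a b c d : lat a b = lat c d -> a = c /\ b = d.
Proof.
move=> e; have := congr1 xcoord e; have := congr1 ycoord e.
by rewrite !xcoord_lat !ycoord_lat => /intr_inj -> /intr_inj ->.
Qed.

Lemma latD a b c d : lat a b + lat c d = lat (a + c) (b + d).
Proof. by rewrite /lat !rmorphD /=; ring. Qed.

Lemma latB a b c d : lat a b - lat c d = lat (a - c) (b - d).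
Proof. by rewrite /lat !rmorphB /=; ring. Qed.

Lemma lat_omega2 a b : omega ^+ 2 * lat a b = lat (- a - b) a.
Proof.
rewrite /lat !rmorphB rmorphN /=.
transitivity ((omega ^+ 2) * a%:~R + (omega ^+ 2) * b%:~R * omega : R[i]); first by ring.
have e : omega * omega = omega - 1 :> R[i] by rewrite -expr2 omega_sqr.
transitivity (a%:~R * omega - a%:~R + b%:~R * (omega * omega - omega) : R[i]).
  by rewrite omega_sqr; ring.
by rewrite e; ring.
Qed.

(** One rotation sends the difference [a - b] to [- 2 * a - b], which is the same modulo 3. *)
Lemma omega2n_lat n a b : exists a' b',
  omega ^+ (2 * n) * lat a b = lat a' b' /\ exists c, a' - b' = a - b + 3 * c.
Proof.
elim: n a b => [|n IH] a b.
  by exists a, b; rewrite muln0 mul1r; split=> //; exists 0; rewrite mulr0 addr0.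
rewrite mulnS addnC exprD -mulrA lat_omega2.
have [a' [b' [-> [c e]]]] := IH (- a - b) a.
by exists a', b'; split=> //; exists (c - a); lia.
Qed.

Lemma modulus_lat a b : modulus (lat a b) ^+ 2 = (a ^+ 2 + a * b + b ^+ 2)%:~R.
Proof.
rewrite sqr_modulus /lat !ReImE ?Re_omega ?cos_pi3 ?Im_omega !rmorphD !rmorphM /=.
have h := height_sqr; set A := a%:~R; set B := b%:~R.
transitivity (A ^+ 2 + A * B + B ^+ 2 / 4 + B ^+ 2 * height ^+ 2 : R).
  by rewrite /A /B; field.
by rewrite h !expr2; field.
Qed.

Lemma deltaE k : delta_vertex R k = lat (k == bullet) (k == star).
Proof.
by rewrite /delta_vertex /lat; elim/deco_ind: k => /=; ring.
Qed.

(** The vertices 0, 1 and [omega] have differences 0, 1 and -1, that is 0, 1 and 2 modulo 3: the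
    numbers of their decorations. *)
Definition residue a b (k : deco) := exists c, a - b = 3 * c + k%:Z.

Definition hex a b := exists c, a - b = 3 * c.

Lemma HexP z : Hex z <-> exists a b, hex a b /\ z = lat a b.
Proof.
split=> [[a [b ->]]|[a [b [[c e] ->]]]].
  exists (2 * a + b), (b - a); split; first by exists a; ring.
  by rewrite /lat !rmorphD rmorphN rmorphM /=; ring.
exists c, (b + c); have -> : a = b + 3 * c by rewrite -e; ring.
by rewrite /lat !rmorphD rmorphM /=; ring.
Qed.

Lemma Gamma_affine g : Gamma333 g -> exists n p,
  [/\ Hex p & forall z, g z = p + omega ^+ (2 * n) * z].
Proof.
elim=> [|k|{}g h _ [n [p [pH gE]]] _ [n' [p' [p'H hE]]]].
- exists 0%N, 0; split=> [|z]; first by exists 0, 0; rewrite !mul0r addr0.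
  by rewrite muln0 expr0 mul1r add0r.
- exists 1%N, (delta_vertex R k - omega ^+ 2 * delta_vertex R k).
  split=> [|z]; last by rewrite /rotation muln1; ring.
  rewrite deltaE lat_omega2 latB; apply/HexP; do 2 eexists; split; last by [].
  elim/deco_ind: k => /=; [by exists 0|by exists 1|by exists 0].
exists (n + n')%N, (p + omega ^+ (2 * n) * p'); split=> [|z]; last first.
  by rewrite /= gE hE mulnDr exprD; ring.
move/HexP: pH => [a [b [ab ->]]]; move/HexP: p'H => {h hE}.
move=> [a' [b' [[c' e'] ->]]]; case: ab => c e.
have [a2 [b2 [-> [c2 e2]]]] := omega2n_lat n a' b'.
rewrite latD; apply/HexP; do 2 eexists; split; last by [].
by exists (c + c' + c2); lia.
Qed.

Lemma Gamma_ext g h : Gamma333 g -> (forall z, g z = h z :> R[i]) -> Gamma333 h.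
Proof. by move=> gG gh; rewrite -(funext gh). Qed.

Lemma omega6 : omega ^+ 6 = 1 :> R[i].
Proof.
rewrite (exprM _ 2 3) omega_sqr.
transitivity ((omega ^+ 2 - 2 * omega + 1) * (omega - 1) : R[i]); first by ring.
rewrite omega_sqr; transitivity (- (omega ^+ 2 - omega) : R[i]); first by ring.
by rewrite omega_sqr; ring.
Qed.

Lemma Gamma_rot n : Gamma333 (fun z => omega ^+ (2 * n) * z : R[i]).
Proof.
elim: n => [|n IH].
  by apply: Gamma_ext (Gamma_id R) _ => z; rewrite muln0 mul1r.
apply: Gamma_ext (Gamma_comp (Gamma_rotation R circ) IH) _ => z /=.
by rewrite /rotation /delta_vertex /= add0r subr0 mulrA -exprD mulnS.
Qed.

Lemma Gamma_translation z0 : Hex z0 -> Gamma333 (fun z => z0 + z).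
Proof.
(* The rotation about vertex [k] preceded by the inverse rotation about 0 is a translation; [bullet]
   and [star] give the two generators of [Hex]. The sign [s] selects the inverse translation. *)
have step k (s : bool) : Gamma333 (fun z =>
    (-1) ^+ s * (delta_vertex R k - omega ^+ 2 * delta_vertex R k) + z).
  have G0 := Gamma_rotation R circ : Gamma333 (rotation (delta_vertex R circ)).
  have Gk := Gamma_rotation R k : Gamma333 (rotation (delta_vertex R k)).
  have G0E z : rotation (delta_vertex R circ) z = omega ^+ 2 * z.
    by rewrite /rotation /delta_vertex /= add0r subr0.
  set d := delta_vertex R k in Gk *.
  have e6 := omega6; have e2 := omega_sqr.
  have e4 : omega ^+ 4 = - omega :> R[i].
    rewrite (exprM _ 2 2) e2.
    transitivity (omega ^+ 2 - 2 * omega + 1 : R[i]); first by ring.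
    by rewrite e2; ring.
  case: s.
    apply: Gamma_ext (Gamma_comp G0 (Gamma_comp Gk Gk)) _ => z /=; rewrite G0E /rotation.
    transitivity (omega ^+ 6 * z + omega ^+ 2 * d - omega ^+ 6 * d : R[i]); first by ring.
    by rewrite e6; ring.
  apply: Gamma_ext (Gamma_comp Gk (Gamma_comp G0 G0)) _ => z /=; rewrite !G0E /rotation.
  transitivity (d - omega ^+ 2 * d + omega ^+ 6 * z : R[i]); first by ring.
  by rewrite e6; ring.
have iter k (a : int) : Gamma333 (fun z =>
    a%:~R * (delta_vertex R k - omega ^+ 2 * delta_vertex R k) + z).
  have nat_iter (s : bool) n : Gamma333 (fun z =>
      (-1) ^+ s * n%:R * (delta_vertex R k - omega ^+ 2 * delta_vertex R k) + z).
    elim: n => [|n IH].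
      by apply: Gamma_ext (Gamma_id R) _ => z; rewrite mulr0 mul0r add0r.
    apply: Gamma_ext (Gamma_comp (step k s) IH) _ => z /=.
    by rewrite -natr1; ring.
  case: a => n; first by apply: Gamma_ext (nat_iter false n) _ => z; rewrite mul1r.
  by apply: Gamma_ext (nat_iter true n.+1) _ => z; rewrite NegzE rmorphN /= expr1 mulN1r.
case=> a [b ->].
apply: Gamma_ext (Gamma_comp (iter bullet a) (iter star b)) _ => z /=.
rewrite /delta_vertex /= omega_sqr mulr1 mulrBl mul1r -expr2 omega_sqr; ring.
Qed.

Lemma decoratedP z k : decorated z k <-> exists a b, residue a b k /\ z = lat a b.
Proof.
split=> [[g /Gamma_affine[n [p [/HexP[a [b [[c e] ->]]] gE]]] <-]|].
  rewrite gE deltaE.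
  have [a' [b' [-> [c' e']]]] := omega2n_lat n (k == bullet) (k == star).
  rewrite latD; do 2 eexists; split; last by [].
  have [d ed] : exists d : int, (k == bullet)%:Z - (k == star)%:Z = 3 * d + k%:Z.
    by elim/deco_ind: k {gE e'} => /=; [exists 0|exists 0|exists (-1)].
  by exists (c + c' + d); lia.
move=> [a [b [[c e] ->]]].
exists (fun z => lat a b - delta_vertex R k + z); last by rewrite subrK.
apply: Gamma_translation; apply/HexP; rewrite deltaE latB; do 2 eexists; split; last by [].
by elim/deco_ind: k e => /= e; [exists c|exists c|exists (c + 1)]; lia.
Qed.

End Lattice.

(** * Tiles: weights, colors and the action of the group *)

Section Tiles.
Variable R : realType.
Implicit Types (v w : deco -> R[i]) (z : R[i]).

Lemma tileP v : tile v <-> unit_equilateral v /\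
  forall k, exists a b, residue a b k /\ v k = lat R a b.
Proof.
split=> [[ev h]|[ev h]]; split=> // k.
  by have [_ /decoratedP] := h k.
have [a [b [r vk]]] := h k; split; first by exists a, b.
by apply/decoratedP; exists a, b.
Qed.

(** The three residues sum to 0 modulo 3, and -2k equals k modulo 3, so the new vertex has the
    decoration of the old one. *)
Lemma tile_vrefl k v : tile v -> tile (vrefl k v).
Proof.
move=> /tileP[ev h]; apply/tileP; split; first exact: vrefl_equilateral.
move=> j; rewrite /vrefl; case: eqVneq => [->|_]; last exact: h.
have [a0 [b0 [[c0 e0] v0]]] := h circ.
have [a1 [b1 [[c1 e1] v1]]] := h bullet.
have [a2 [b2 [[c2 e2] v2]]] := h star.
have [a [b [[c e] vk]]] := h k.
rewrite sum_deco v0 v1 v2 vk mulr2n !latD latB; do 2 eexists; split; last by [].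
exists (c0 + c1 + c2 - 2 * c + 1 - k%:Z); move: e0 e1 e2 e => /=; lia.
Qed.

Lemma Gamma_modulus g (z z' : R[i]) : Gamma333 g -> modulus (g z - g z') = modulus (z - z').
Proof.
move=> /Gamma_affine[n [p [_ gE]]]; rewrite !gE.
have -> : p + omega ^+ (2 * n) * z - (p + omega ^+ (2 * n) * z') = omega ^+ (2 * n) * (z - z').
  by ring.
suff o1 : modulus (omega ^+ (2 * n)) = 1 :> R by rewrite modulusM o1 mul1r.
elim: (2 * n)%N => [|m IH]; first by rewrite expr0 ComplexField.Normc.normc1.
rewrite exprS modulusM IH mulr1.
by rewrite /modulus /omega cos2Dsin2 sqrtr1.
Qed.

Lemma Gamma_barycenter g v b : Gamma333 g -> \sum_k b k = 1 ->
  g (barycenter v b) = barycenter (g \o v) b.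
Proof.
move=> /Gamma_affine[n [p [_ gE]]] b1.
transitivity (((\sum_k b k)%:C) * p + omega ^+ (2 * n) * barycenter v b).
  by rewrite b1 mul1r gE.
by rewrite /barycenter !sum_deco /= !gE !rmorphD; ring.
Qed.

Lemma Gamma_positive g v : Gamma333 g -> positive (g \o v) = positive v.
Proof.
move=> /Gamma_affine[n [p [_ gE]]]; rewrite /positive /= !gE.
have -> : (p + omega ^+ (2 * n) * v bullet - (p + omega ^+ (2 * n) * v circ))^*%C *
  (p + omega ^+ (2 * n) * v star - (p + omega ^+ (2 * n) * v circ)) =
  (omega ^+ (2 * n) * (omega ^+ (2 * n))^*%C) * ((v bullet - v circ)^*%C * (v star - v circ)).
  rewrite !rmorphB !rmorphD !rmorphM /=; ring.
suff -> : omega ^+ (2 * n) * (omega ^+ (2 * n))^*%C = 1 :> R[i] by rewrite mul1r.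
rewrite rmorphXn /= -exprMn.
suff -> : omega * omega^*%C = 1 :> R[i] by rewrite expr1n.
have := cos2Dsin2 (2 * pi / 6 : R).
by rewrite /omega => h; apply: complex_ext; rewrite !ReImE /=; lra.
Qed.

Lemma Gamma_tile g v : Gamma333 g -> tile v -> tile (g \o v).
Proof.
move=> gG [ev h]; split=> [i j ij|k]; first by rewrite /= Gamma_modulus // ev.
have [_ [g' g'G gv]] := h k.
have dk : decorated (g (v k)) k by exists (g \o g'); [exact: Gamma_comp|rewrite /= gv].
by have /decoratedP[a [b [_ e]]] := dk; split=> //; exists a, b.
Qed.

Lemma double_tile c : tile (double_vertex R c).
Proof.
apply/tileP; split; first exact: double_equilateral.
move=> k; have [d [e [r dk]]] : exists a b, residue a b k /\ delta_vertex R k = lat R a b.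
  by apply/decoratedP; exists id; [exact: Gamma_id|].
case: c; first by exists d, e.
move: d e r dk; elim/deco_ind: k => a b _ _.
- by exists 0, 0; split; [exists 0|apply: complex_ext; rewrite /lat /= ?ReImE; lra].
- by exists 1, 0; split; [exists 0|apply: complex_ext; rewrite /lat /= ?ReImE; lra].
- exists 1, (-1); split; [by exists 0|].
  by apply: complex_ext; rewrite /lat /= ?ReImE ?cos_pi3; lra.
Qed.

Lemma tile_edge v i j a b c d : tile v -> v i = lat R a b -> v j = lat R c d ->
  [/\ `|a - c| <= 1, `|b - d| <= 1 & `|a - c + (b - d)| <= 1].
Proof.
move=> [ev _] vi vj.
suff : (a - c) ^+ 2 + (a - c) * (b - d) + (b - d) ^+ 2 <= 1.
  by move: (a - c) (b - d) => x y h; split; nia.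
case: (eqVneq i j) => [ij|ij].
  by move: vi; rewrite ij vj => /lat_inj[-> ->]; rewrite !subrr.
have := ev i j ij; rewrite vi vj latB => /(congr1 (fun x => x ^+ 2)).
by rewrite modulus_lat expr1n => /(@intr_inj R _ 1) ->.
Qed.

Definition coordinate (L : R[i] -> R) :=
  [\/ L = @xcoord R, L = @ycoord R | L = fun z => xcoord z + ycoord z].

Lemma coordinate_barycenter L v b : coordinate L -> L (barycenter v b) = \sum_k b k * L (v k).
Proof.
case=> ->; rewrite ?xcoord_barycenter ?ycoord_barycenter //.
by rewrite !sum_deco; ring.
Qed.

(** Only the other vertices contribute: they have total weight [1 - b k], and by [tile_edge] [L]
    differs there by at most 1. *)
Lemma tile_coordinate L v b k : coordinate L -> tile v -> weights b ->
  `|L (barycenter v b) - L (v k)| <= 1 - b k.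
Proof.
move=> hL tv [b0 b1]; rewrite coordinate_barycenter //.
have edge j : `|L (v j) - L (v k)| <= (j != k)%:R.
  case: (eqVneq j k) => [->|jk]; first by rewrite subrr normr0.
  have /tileP[ev h] := tv.
  have [p [q [_ vj]]] := h j; have [r [s [_ vk]]] := h k.
  have [h1 h2 h3] := tile_edge tv vj vk.
  rewrite -(ler_int R) intr_norm !(rmorphD, rmorphN) /= in h1.
  rewrite -(ler_int R) intr_norm !(rmorphD, rmorphN) /= in h2.
  rewrite -(ler_int R) intr_norm !(rmorphD, rmorphN) /= in h3.
  case: hL => -> /=; rewrite vj vk ?xcoord_lat ?ycoord_lat //.
  by apply: le_trans h3; rewrite opprD addrACA.
have -> : \sum_j b j * L (v j) - L (v k) = \sum_j b j * (L (v j) - L (v k)).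
  by under [RHS]eq_bigr do rewrite mulrBr; rewrite big_split /= sumrN -mulr_suml b1 mul1r.
apply: le_trans (ler_norm_sum _ _ _) _.
have -> : 1 - b k = \sum_j b j * (j != k)%:R.
  by move: b1; rewrite !sum_deco => b1; elim/deco_ind: k {edge} => /=; lra.
by apply: ler_sum => j _; rewrite normrM ger0_norm // ler_wpM2l.
Qed.

(* Distinct lattice points with the same decoration differ by at least 2 in one
   of the three coordinates x, y and x + y, each of which varies by at most
   1 - b k between the vertex k and the point of weights b of a tile. *)
Lemma tile_weights v w b d : tile v -> tile w -> weights b -> weights d ->
  barycenter v b = barycenter w d -> b = d /\ forall k, v k = w k \/ b k = 0.
Proof.
move=> tv tw wb wd e.
have key k : v k = w k \/ b k = 0 /\ d k = 0.
  case: (pselect (v k = w k)) => [|vw]; [by left|right].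
  have /tileP[_ /(_ k)[p [q [[c e1] vk]]]] := tv.
  have /tileP[_ /(_ k)[r [s [[c' e2] wk]]]] := tw.
  have bk := (proj1 wb) k; have dk := (proj1 wd) k.
  suff [L hL h] : exists2 L, coordinate L & 2 <= `|L (v k) - L (w k)|.
    (* Thus 2 is at most [(1 - b k) + (1 - d k)], and both weights vanish. *)
    have h1 := tile_coordinate k hL tv wb; have h2 := tile_coordinate k hL tw wd.
    move: h1 h2 h; rewrite e ler_norml ler_norml ler_normr => /andP[? ?] /andP[? ?] /orP[?|?]; lra.
  have : [\/ 2 <= `|p - r|, 2 <= `|q - s| | 2 <= `|p - r + (q - s)|].
    apply: contrapT => h; apply: vw.
    have h1 : ~~ (2 <= `|p - r|) by apply/negP => h1; apply: h; constructor 1.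
    have h2 : ~~ (2 <= `|q - s|) by apply/negP => h2; apply: h; constructor 2.
    have h3 : ~~ (2 <= `|p - r + (q - s)|) by apply/negP => h3; apply: h; constructor 3.
    (* The differences [p - r] and [q - s] are at most 1 in absolute value and congruent modulo 3,
       hence equal; their sum is also at most 1 in absolute value, so they are 0. *)
    have [pr qs] : p = r /\ q = s by lia.
    by rewrite vk wk pr qs.
  rewrite vk wk => -[] h; rewrite -(ler_int R) intr_norm !(rmorphD, rmorphN) /= in h.
  - by exists (@xcoord R); [constructor 1|rewrite !xcoord_lat].
  - by exists (@ycoord R); [constructor 2|rewrite !ycoord_lat].
  - exists (fun z => xcoord z + ycoord z); [constructor 3 => //|rewrite !xcoord_lat !ycoord_lat].
    by apply: le_trans h _; rewrite opprD addrACA.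
split; last by move=> k; case: (key k) => [|[]]; [left|right].
apply: (barycenter_inj (v := v)); first by case: tv.
  by rewrite (proj2 wb) (proj2 wd).
rewrite e; apply: eq_barycenter => // k.
by case: (key k) => [->|[_ ->]]; [right|left].
Qed.

Lemma tile_color v w b d : tile v -> tile w -> weights b -> weights d ->
  barycenter v b = barycenter w d -> positive v = positive w \/ exists k, b k = 0.
Proof.
move=> tv tw wb wd /(tile_weights tv tw wb wd)[_ h].
case: (pselect (exists k, b k = 0)) => hb; [by right|left].
congr positive; apply/funext => k; case: (h k) => // bk.
by case: hb; exists k.
Qed.

Lemma tile_standard v : tile v -> v circ = 0 -> v bullet = 1 ->
  forall k, v k = double_vertex R (positive v) k.
Proof.
move=> tv v0 v1; have /tileP[ev h] := tv.
have [r [s [[c e] v2]]] := h star.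
have n1 : r ^+ 2 + r * s + s ^+ 2 = 1.
  apply: (@intr_inj R); rewrite -modulus_lat -v2 -[v star]subr0 -v0.
  by rewrite ev // expr1n.
have n2 : (r - 1) ^+ 2 + (r - 1) * s + s ^+ 2 = 1.
  apply: (@intr_inj R); rewrite -(subr0 s) -modulus_lat -latB -v2.
  have -> : lat R 1 0 = v bullet by rewrite v1 /lat mul0r addr0.
  by rewrite ev // expr1n.
have h0 := height_gt0 R.
have [[re se]|[re se]] : r = 0 /\ s = 1 \/ r = 1 /\ s = -1.
- have se : s = 1 - 2 * r by lia.
  have : r * (r - 1) = 0.
    have : 3 * (r * (r - 1)) = 0 by rewrite se in n1; lia.
    lia.
  by move=> /eqP; rewrite mulf_eq0 => /orP[|] /eqP ?; lia.
- have -> : positive v.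
    by rewrite /positive v0 v1 !subr0 conjc1 mul1r v2 re se /lat !ReImE ?Im_omega; lra.
  by elim/deco_ind; rewrite ?v0 ?v1 // v2 re se /lat add0r mul1r.
- have -> : positive v = false.
    apply/negbTE; rewrite -leNgt v0 v1 !subr0 conjc1 mul1r v2 re se /lat !ReImE ?Im_omega; lra.
  elim/deco_ind; rewrite ?v0 ?v1 /double_vertex /delta_vertex /= ?conjc0 ?conjc1.
  all: apply: complex_ext; rewrite ?v2 ?re ?se /lat /= ?ReImE ?cos_pi3; lra.
Qed.

(** Among the six lattice points of modulus 1, those of residue 1 are 1, [- omega] and [omega ^+ 2],
    a single orbit of the rotation. *)
Lemma tile_rotation v : tile v -> v circ = 0 -> exists n, omega ^+ (2 * n) * v bullet = 1.
Proof.
move=> /tileP[ev h] v0.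
have [p [q [[c e] v1]]] := h bullet.
have n1 : p ^+ 2 + p * q + q ^+ 2 = 1.
  apply: (@intr_inj R); rewrite -modulus_lat -v1 -[v bullet]subr0 -v0.
  by rewrite ev // expr1n.
have lat10 : lat R 1 0 = 1 by rewrite /lat mul0r addr0.
have p1 : `|p| <= 1 by nia.
have q1 : `|q| <= 1 by nia.
have [[pe qe]|[[pe qe]|[pe qe]]] :
    p = 1 /\ q = 0 \/ p = 0 /\ q = -1 \/ p = -1 /\ q = 1.
- have hp : p = -1 \/ p = 0 \/ p = 1 by lia.
  have hq : q = -1 \/ q = 0 \/ q = 1 by lia.
  move: e => /= e.
  by case: hp => [pE|[pE|pE]]; case: hq => [qE|[qE|qE]]; rewrite pE qE in n1 e *; lia.
- by exists 0%N; rewrite v1 pe qe lat10 mulr1.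
- by exists 1%N; rewrite v1 pe qe muln1 lat_omega2.
- by exists 2%N; rewrite v1 pe qe (exprD _ 2 2) -mulrA !lat_omega2.
Qed.

(** The group is transitive on the tiles of each color: a translation brings the [circ] vertex to 0,
    a rotation brings [bullet] to 1, and the color then fixes [star]. *)
Lemma tile_Gamma v : tile v ->
  exists2 g, Gamma333 g & forall k, g (v k) = double_vertex R (positive v) k.
Proof.
move=> tv; have /tileP[_ /(_ circ)[a [b [[c e] vc]]]] := tv.
pose T z := lat R (- a) (- b) + z.
have TG : Gamma333 T.
  apply: Gamma_translation; apply/HexP; do 2 eexists; split; last by [].
  by exists (- c); move: e => /=; lia.
have T0 : (T \o v) circ = 0 by rewrite /T /= vc latD !addNr /lat mul0r addr0.
have tT : tile (T \o v) by exact: Gamma_tile.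
have [n hn] := tile_rotation tT T0.
have rG := Gamma_rot R n; set r := (fun z => _) in rG.
have gG : Gamma333 (r \o T) by exact: Gamma_comp.
exists (r \o T) => // k; rewrite -(Gamma_positive v gG).
apply: (tile_standard (v := (r \o T) \o v)); first exact: Gamma_tile.
  by rewrite /= /r -[T _]/((T \o v) circ) T0 mulr0.
exact: hn.
Qed.

End Tiles.

(** * The tiles cover the plane; the projection is well defined *)

Section Cover.
Variable R : realType.
Implicit Types (v : deco -> R[i]) (z : R[i]).

Lemma lat_unit a b : a ^+ 2 + a * b + b ^+ 2 = 1 -> modulus (lat R a b) = 1.
Proof.
move=> h; apply/eqP; rewrite -(@eqrXn2 _ 2) ?modulus_ge0 //.
by rewrite modulus_lat h expr1n.
Qed.

(** A triangle whose residues are all off by [r] becomes a tile by renaming its vertices; each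
    cyclic renaming lowers [r] by one. *)
Lemma tile_shift z (r : nat) v : unit_equilateral v ->
  (forall k : deco, exists a b, (exists c : int, a - b = 3 * c + k%:Z + r%:Z) /\ v k = lat R a b) ->
  solid v z -> exists2 w, tile w & solid w z.
Proof.
elim: r v => [|r IH] v ev hv [b wb zb].
  exists v; last by exists b.
  apply/tileP; split=> // k; have [x [y [[c e] vk]]] := hv k.
  by exists x, y; split=> //; exists c; rewrite e addr0.
pose rot (k : deco) : deco := nth circ [:: star; circ; bullet] k.
apply: (IH (v \o rot)).
- move=> i j; move: (ev (rot i) (rot j)) => + ij; apply.
  by move: ij; elim/deco_ind: i; elim/deco_ind: j.
- move=> k; have [x [y [[c e] vk]]] := hv (rot k).
  exists x, y; split=> //; exists (c + (k == circ)); rewrite e.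
  by elim/deco_ind: k {vk e} => /=; lia.
- exists (b \o rot); last first.
    by rewrite zb /barycenter !sum_deco /=; ring.
  case: wb => b0 b1; split=> [k|]; first exact: b0.
  by rewrite -b1 !sum_deco /=; ring.
Qed.

Lemma tile_cover z : exists2 v, tile v & solid v z.
Proof.
pose i := Num.floor (xcoord z); pose j := Num.floor (ycoord z).
pose x := xcoord z - i%:~R; pose y := ycoord z - j%:~R.
have /andP[x0 x1] : 0 <= x < 1.
  by rewrite /x /i; have := floor_itv (xcoord z); rewrite rmorphD /=; lra.
have /andP[y0 y1] : 0 <= y < 1.
  by rewrite /y /j; have := floor_itv (ycoord z); rewrite rmorphD /=; lra.
have zx : xcoord z = i%:~R + x by rewrite /x; ring.
have zy : ycoord z = j%:~R + y by rewrite /y; ring.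
clearbody x y.
pose r := `|((i - j) %% 3)%Z|%N.
have [q ijq] : exists q : int, i - j = 3 * q + r%:Z.
  exists ((i - j) %/ 3)%Z; rewrite /r gez0_abs ?modz_ge0 //.
  by rewrite {1}(divz_eq (i - j) 3); ring.
(* The diagonal [x + y = 1] cuts the unit parallelogram into two equilateral triangles. *)
case: (leP (x + y) 1) => xy.
  apply: (@tile_shift _ r (fun k => lat R (i + (k == bullet)) (j + (k == star)))).
  - move=> k l; rewrite latB => kl; apply: lat_unit; move: kl.
    by elim/deco_ind: k; elim/deco_ind: l => //= _; ring.
  - move=> k; do 2 eexists; split; last by [].
    exists (q - (k == star)%:Z).
    by elim/deco_ind: k => /=; lia.
  - exists (fun k => nth 0 [:: 1 - x - y; x; y] k).
      split; last by rewrite sum_deco /=; ring.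
      by elim/deco_ind => /=; lra.
    apply: coord_ext.
      by rewrite xcoord_barycenter sum_deco !xcoord_lat /= zx !rmorphD /=; ring.
    by rewrite ycoord_barycenter sum_deco !ycoord_lat /= zy !rmorphD /=; ring.
apply: (@tile_shift _ r (fun k => lat R (i + (k != star)) (j + (k != bullet)))).
- move=> k l; rewrite latB => kl; apply: lat_unit; move: kl.
  by elim/deco_ind: k; elim/deco_ind: l => //= _; ring.
- move=> k; do 2 eexists; split; last by [].
  exists (q - (k == star)%:Z).
  by elim/deco_ind: k => /=; lia.
- exists (fun k => nth 0 [:: x + y - 1; 1 - y; 1 - x] k).
    split; last by rewrite sum_deco /=; ring.
    by elim/deco_ind => /=; lra.
  apply: coord_ext.
    by rewrite xcoord_barycenter sum_deco !xcoord_lat /= zx !rmorphD /=; ring.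
  by rewrite ycoord_barycenter sum_deco !ycoord_lat /= zy !rmorphD /=; ring.
Qed.

(** Two vanishing weights would put the point at a vertex. The [k] obtained names the rhombus used
    around the point. *)
Lemma tile_nonvertex v b : tile v -> weights b -> ~ lattice (barycenter v b) ->
  exists k, forall j, j != k -> 0 < b j.
Proof.
move=> [_ tv] [b0 b1] nl.
have vert k : ~ (forall j, j != k -> b j = 0).
  move=> h; apply: nl; suff -> : barycenter v b = v k by case: (tv k).
  rewrite -(barycenter_vertex v k); congr barycenter; apply/funext => j.
  rewrite /vertex_weights; case: eqVneq => [->|]; last exact: h.
  by rewrite -b1 (bigD1 k) //= big1 ?addr0.
have pos j : b j != 0 -> 0 < b j by move=> bj; rewrite lt_def bj b0.
case: (eqVneq (b circ) 0) => h0.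
  exists circ; elim/deco_ind => // _; apply: pos; apply/eqP => h.
  - by apply: (vert star); elim/deco_ind.
  - by apply: (vert bullet); elim/deco_ind.
case: (eqVneq (b bullet) 0) => h1.
  exists bullet; elim/deco_ind => // _; apply: pos => //; apply/eqP => h.
  by apply: (vert circ); elim/deco_ind.
by exists star; elim/deco_ind => // _; apply: pos.
Qed.

Lemma interior_open v b : unit_equilateral v -> \sum_k b k = 1 -> (forall k, 0 < b k) ->
  exists2 r, 0 < r & forall z, modulus (z - barycenter v b) < r ->
    exists d, [/\ weights d, forall k, 0 < d k & z = barycenter v d].
Proof.
move=> ev b1 b0.
have [e e0 he] := lower_bound (k := circ) (fun j _ => b0 j).
pose e' := Num.min e (b circ).
have e'0 : 0 < e' by rewrite lt_min e0 b0.
have he' k : e' <= b k.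
  by rewrite ge_min; case: (eqVneq k circ) => [->|/he ->//]; rewrite lexx orbT.
exists (e' / 2) => [|z zr]; first lra.
have [d d1 zd] := barycenter_surj z ev.
have pos k : 0 < d k.
  have : `|d k - b k| <= 2 * modulus (z - barycenter v b).
    by rewrite zd; apply: coordinate_lipschitz; rewrite // d1.
  by rewrite ler_norml => /andP[h _]; have := he' k; lra.
by exists d; split=> //; split=> // k; exact: ltW.
Qed.

Lemma positive_vrefl v k : unit_equilateral v -> positive (vrefl k v) = ~~ positive v.
Proof.
move=> ev.
(* Twice the signed area, which a reflection negates. *)
pose D w := (complex.Re (w bullet) - complex.Re (w circ)) * (complex.Im (w star) - complex.Im (w circ)) -
  (complex.Im (w bullet) - complex.Im (w circ)) * (complex.Re (w star) - complex.Re (w circ)) : R.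
have pE w : positive w = (0 < D w).
  rewrite /positive /D; case: (w circ) (w bullet) (w star) => [a b] [c d] [e f] /=.
  by congr (_ < _); ring.
have D0 : D v != 0.
  have h1 : _ = _ := edge_sqr (i := circ) (j := bullet) ev isT.
  have h2 : _ = _ := edge_sqr (i := circ) (j := star) ev isT.
  have h3 : _ = _ := edge_sqr (i := bullet) (j := star) ev isT.
  have D2 : D v ^+ 2 = 3 / 4.
    set A := LHS in h1; set B := LHS in h2; set C := LHS in h3.
    transitivity (A * B - ((A + B - C) / 2) ^+ 2); last by rewrite h1 h2 h3; field.
    by rewrite /A /B /C /D; field.
  by apply/eqP => D0; move: D2; rewrite D0; lra.
have DN : D (vrefl k v) = - D v.
  by rewrite /D /vrefl !sum_deco; elim/deco_ind: k => /=; rewrite !ReImE; ring.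
by rewrite !pE DN oppr_gt0 -leNgt le_eqVlt (negbTE D0).
Qed.

Lemma positive_double c : positive (double_vertex R c) = c.
Proof.
have ht : positive (double_vertex R true).
  by rewrite /positive /double_vertex /delta_vertex /=; have := sin_pi3_gt0 R; lra.
by case: c => //; rewrite (double_oriented R circ true) ht.
Qed.

(** Whatever group element [xget] picks, [tile_weights] forces the same weights. The color can
    differ only for a point on a side, and there the two triangles of the sphere are glued. *)
Lemma projection_tile v b : tile v -> weights b ->
  projection (barycenter v b) = wpt (positive v : triangle (doubleDelta R)) b.
Proof.
move=> tv wb; rewrite /projection; case: xgetP => [x _ [g gG [c [[d wd gz] ->]]]|h]; last first.
  have [g gG gE] := tile_Gamma tv.
  case: (h (wpt (positive v : triangle (doubleDelta R)) b)).
  have gz : g (barycenter v b) = barycenter (double_vertex R (positive v)) b.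
    by rewrite Gamma_barycenter ?(proj2 wb) //; congr barycenter; apply/funext.
  exists g => //; exists (positive v); rewrite gz; split=> //.
  exact: solid_barycenter.
have tg := Gamma_tile gG tv; have td := double_tile R c.
have e : barycenter (g \o v) b = barycenter (double_vertex R c) d.
  by rewrite -Gamma_barycenter ?(proj2 wb).
have [bd _] := tile_weights tg td wb wd e; subst d.
rewrite gz -/(wpt c b).
case: (tile_color tg td wb wb e) => [|[k bk]].
  by rewrite Gamma_positive // positive_double => ->.
case: (eqVneq c (positive v)) => [->//|cp].
have -> : c = ~~ positive v by case: c (positive v) cp {gz td e wd} => [] [].
exact: (wpt_glue (X := doubleDelta R) (k := k)).
Qed.

End Cover.

(** * Maps given tile by tile along the line *)

Section Develop.
Variables (R : realType) (X : decorated_triangulation R).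
Variables (z0 u : R[i]).
Local Notation line := (fun t : R => z0 + t%:C * u).
Hypothesis line_lattice : forall t, ~ lattice (line t).

(** A common form for the development in [X] and the projection onto the sphere, so that both paths
    are handled at once. *)
Definition tilewise (Psi : R[i] -> surface X) := forall v, tile v ->
  (exists t, solid v (line t)) ->
  exists2 T : triangle X, black T = positive v &
    forall b, weights b -> Psi (barycenter v b) = wpt T b.

Lemma line_near t r : 0 < r ->
  exists2 e, 0 < e & forall s, `|s - t| < e -> modulus (line s - line t) < r.
Proof.
move=> r0; have mu := modulus_ge0 u; have m1 : 0 < modulus u + 1 by lra.
exists (r / (modulus u + 1)); first by rewrite divr_gt0.
move=> s; rewrite ltr_pdivlMr // => sr.
have -> : line s - line t = (s - t)%:C * u by rewrite rmorphB /=; ring.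
rewrite modulusM modulus_real.
by have := normr_ge0 (s - t); set x := `|_| in sr *; nra.
Qed.

Lemma tilewise_unfolded Psi : tilewise Psi -> unfolded_path (Psi \o line) u.
Proof.
move=> hPsi t0; have [v tv [b wb lb]] := tile_cover (line t0).
have [|k bk] := tile_nonvertex tv wb; first by rewrite -lb; exact: line_lattice.
have ev : unit_equilateral v by case: tv.
have [|T bT PsiT] := hPsi v tv; first by exists t0, b.
have lE s : line t0 + (s - t0)%:C * u = line s by rewrite rmorphB /=; ring.
have hr : rhombus v k (line t0) by exists false, b.
exists v, T, k, (line t0); split=> //.
have [bk0|bk0] := eqVneq (b k) 0; last first.
  have b0 j : 0 < b j.
    by case: (eqVneq j k) => [->|/bk//]; rewrite lt_def bk0 (proj1 wb).
  have [r r0 ho] := interior_open ev (proj2 wb) b0.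
  have [e e0 he] := line_near t0 r0.
  apply/near_ballP; exists e => // s /he; rewrite lE {1}lb => /ho[d [wd _ ld]].
  by rewrite /= ld PsiT // -[v]/(half v k false) unfoldE.
have [|T' bT' PsiT'] := hPsi _ (tile_vrefl k tv).
  by exists t0, b => //; rewrite lb barycenter_vrefl wrefl_eq0.
(* The images of a tile and of its mirror image share a point inside side [k]; as their colors
   differ, they are not the same triangle. *)
have T'E : T' = glue k T.
  have := PsiT b wb; have := PsiT' b wb; rewrite barycenter_vrefl wrefl_eq0 // => ->.
  move=> /(wpt_eqP wb wb)[_ /(_ k (fun j jk => lt0r_neq0 (bk j jk)))].
  case=> [e|[_ ->]]; last by rewrite glueK.
  by move: bT; rewrite e bT' positive_vrefl //; case: positive.
have [r r0 ho] := rhombus_open ev hr.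
have [e e0 he] := line_near t0 r0.
apply/near_ballP; exists e => // s /he /ho; rewrite lE => -[h [d [wd _ ld]]].
rewrite /= ld unfoldE //; case: h {ld}; last exact: PsiT.
by rewrite /= -T'E; exact: PsiT'.
Qed.

End Develop.

Section Belyi.
Variables (R : realType) (X : decorated_triangulation R).

Lemma belyi_wpt (f : surface X -> sphere R) : belyi_function f ->
  forall (t : triangle X) b, weights b ->
    f (wpt t b) = wpt (black t : triangle (doubleDelta R)) b.
Proof.
move=> hf t b wb; have [c [h [bc hh fE]]] := hf t.
rewrite /wpt fE; last exact: solid_barycenter.
rewrite (deco_isometryE _ _ hh) //; try exact: vertex_equilateral.
by rewrite -bc /black positive_double.
Qed.

Lemma development_tilewise l p (Psi : R[i] -> surface X) z0 u :
  (forall t, l t = z0 + t%:C * u) -> development l p Psi -> tilewise z0 u Psi.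
Proof.
move=> lE [_ _ h] v tv [t vt]; have [|T [g [bT gT gE]]] := h v tv.
  by exists t; rewrite lE.
exists T => // b wb; rewrite gE; last exact: solid_barycenter.
rewrite (deco_isometryE _ _ gT) //; [by case: tv|exact: vertex_equilateral].
Qed.

Lemma projection_tilewise z0 u : tilewise (X := doubleDelta R) z0 u (@projection R).
Proof.
move=> v tv _; exists (positive v); first by rewrite /black positive_double.
by move=> b wb; rewrite projection_tile.
Qed.

End Belyi.

(** * Midpoints of edges and orbits of a permutation *)

Section Midpoints.
Variables (R : realType) (X : decorated_triangulation R).

Lemma halfC : 1 / 2 = (1 / 2 : R)%:C :> R[i].
Proof. by rewrite fmorph_div rmorph1 rmorph_nat. Qed.

Definition midpoint_weights : deco -> R := fun k => nth 0 [:: 1 / 2; 1 / 2; 0] k.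

Lemma weights_midpoint : weights midpoint_weights.
Proof.
split; last by rewrite sum_deco /midpoint_weights /=; lra.
by elim/deco_ind; rewrite /midpoint_weights /=; lra.
Qed.

Lemma midpointE (e : dessin_edge X) : exists t : triangle X,
  val e = [set t; glue star t]%SET /\ midpoint e = wpt t midpoint_weights.
Proof.
rewrite /midpoint; set P := existsP _.
exists (xchoose P); split; first exact/eqP/(xchooseP P).
rewrite /wpt; congr pt; rewrite /barycenter sum_deco /midpoint_weights /=.
rewrite -[RHS]/((1 / 2 : R)%:C * vertex (xchoose P) circ +
  (1 / 2 : R)%:C * vertex (xchoose P) bullet + 0%:C * vertex (xchoose P) star).
by rewrite -halfC; ring.
Qed.

(** Only the weight of [star] vanishes at a midpoint, so its triangle is known up to [glue star],
    and both triangles give the same edge. *)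
Lemma midpoint_inj : injective (@midpoint R X).
Proof.
move=> e e'; have [t [eE ->]] := midpointE e; have [t' [e'E ->]] := midpointE e'.
have w := weights_midpoint => /(wpt_eqP w w)[_ /(_ star) h].
apply: val_inj; rewrite eE e'E; case: h => [|->//|[_ ->]].
  by elim/deco_ind => // _; rewrite /midpoint_weights /=; apply/eqP; lra.
by rewrite glueK finset.setUC.
Qed.

End Midpoints.

Section PorbitMin.

Lemma porbit_le (T : finType) (s : {perm T}) (x : T) k :
  (0 < k)%N -> iter k s x = x -> (#|porbit s x| <= k)%N.
Proof.
move=> k0 sk; rewrite leqNgt; apply/negP => kN.
have N0 : (0 < #|porbit s x|)%N by exact: leq_trans kN.
have := nth_uniq x (s := traject s x #|porbit s x|) (i := 0) (j := k).
rewrite size_traject => /(_ N0 kN (uniq_traject_porbit s x)).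
by rewrite !nth_traject //= sk eqxx eq_sym (gtn_eqF k0).
Qed.

End PorbitMin.

(** * Arithmetic of the line and the periods of its projection *)

Section Line.
Variables (R : realType) (m n : int).
Hypotheses (mn_coprime : coprimez m n) (n_odd : odd `|n|%N).
Let u : R[i] := lat R m n.
Local Notation line := (fun t : R => 1 / 2 + t%:C * u).

Lemma xcoord_line t : xcoord (line t) = 1 / 2 + t * m%:~R.
Proof.
have -> : line t = (1 / 2 + t * m%:~R)%:C + (t * n%:~R)%:C * omega.
  by rewrite halfC /u /lat !intrC rmorphD !rmorphM; ring.
by rewrite (coordK _ _).1.
Qed.

Lemma ycoord_line t : ycoord (line t) = t * n%:~R.
Proof.
have -> : line t = (1 / 2 + t * m%:~R)%:C + (t * n%:~R)%:C * omega.
  by rewrite halfC /u /lat !intrC rmorphD !rmorphM; ring.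
by rewrite (coordK _ _).2.
Qed.

Lemma n_neq0 : n != 0.
Proof. by apply: contraTneq n_odd => ->. Qed.

Lemma u_neq0 : u != 0.
Proof.
apply/eqP => u0; have := ycoord_lat R m n; rewrite -/u u0 /ycoord Im0 mul0r.
by move=> /eqP; rewrite eq_sym intr_eq0 (negbTE n_neq0).
Qed.

(** Eliminating [t] makes [n] times the odd number [2 * a - 1] equal to the even number
    [2 * m * b]. *)
Lemma line_notin_lattice t : ~ lattice (line t).
Proof.
move=> [a [b e]]; rewrite -/(lat R a b) in e.
have ex : 1 / 2 + t * m%:~R = a%:~R by rewrite -xcoord_line e xcoord_lat.
have ey : t * n%:~R = b%:~R by rewrite -ycoord_line e ycoord_lat.
have : n + 2 * (m * b) = 2 * (n * a).
  apply: (@intr_inj R); rewrite !(rmorphD, rmorphM) /= -ex -ey.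
  by field.
by move: n_odd; lia.
Qed.

Lemma projection_Gamma g (z : R[i]) : Gamma333 g -> projection (g z) = projection z.
Proof.
move=> gG; have [v tv [b wb ->]] := tile_cover z.
rewrite Gamma_barycenter ?(proj2 wb) // !projection_tile //; last exact: Gamma_tile.
by rewrite Gamma_positive.
Qed.

Lemma projection_period T t : Hex (T%:C * u) -> projection (line (t + T)) = projection (line t).
Proof.
move=> h; rewrite -(projection_Gamma (line t) (Gamma_translation h)).
by congr projection; rewrite rmorphD /=; ring.
Qed.

Lemma line_interior : exists t b, [/\ weights b, forall k, 0 < b k
  & line t = barycenter (double_vertex R true) b].
Proof.
have n0 : (n%:~R : R) != 0 by rewrite intr_eq0 n_neq0.
(* At height [e] above the midpoint of the base the line has moved sideways by [e * q]. The choice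
   of [e] bounds this by [1 / 4 - e], so the weights of [circ] and [bullet] stay at least
   [1 / 4]. *)
pose q : R := m%:~R / n%:~R; pose e : R := (4 * (1 + `|q|))^-1.
have q1 : 0 < 1 + `|q| by have := normr_ge0 q; lra.
have e0 : 0 < e by rewrite invr_gt0; lra.
have e1 : e * (1 + `|q|) = 1 / 4 by rewrite /e; field; rewrite lt0r_neq0.
have e2 : `|e * q| = e * `|q| by rewrite normrM gtr0_norm.
have /andP[h1 h2] : - (1 / 4 - e) <= e * q <= 1 / 4 - e.
  by rewrite -ler_norml e2; lra.
have e3 : e <= 1 / 4 by have := normr_ge0 (e * q); lra.
pose b := (fun k => nth 0 [:: 1 / 2 - e * q - e; 1 / 2 + e * q; e] k : R) : deco -> R.
have b0 k : 0 < b k by rewrite /b; elim/deco_ind: k => /=; lra.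
exists (e / n%:~R), b; split=> //.
  by split=> [k|]; [exact: ltW|rewrite sum_deco /b /=; lra].
apply: coord_ext.
  rewrite xcoord_line xcoord_barycenter sum_deco /double_vertex !deltaE !xcoord_lat /b /q /=.
  by field.
rewrite ycoord_line ycoord_barycenter sum_deco /double_vertex !deltaE !ycoord_lat /b /=.
by field.
Qed.

(** At an interior point of a tile the projection determines the weights and the color, so a single
    group element undoes the shift for all times near [t]. *)
Lemma period_Hex T : (forall t, projection (line (t + T)) = projection (line t)) ->
  Hex (T%:C * u).
Proof.
move=> hT; have [t [b [wb b0 lt]]] := line_interior.
pose v := double_vertex R true; have tv : tile v := double_tile R true.
have [v' tv' [b' wb' lt']] := tile_cover (line (t + T)).
have pv : positive v = true := positive_double R true.
have same d d' : weights d -> weights d' -> (forall k, 0 < d k) ->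
    projection (barycenter v' d') = projection (barycenter v d) -> d = d' /\ positive v' = true.
  move=> wd wd' d0; rewrite !projection_tile // pv => /esym /(wpt_eqP wd wd')[dd' /(_ circ) h].
  split=> //; case: h => [j _|//|[dc _]]; first by rewrite lt0r_neq0.
  by have := d0 circ; rewrite dc ltxx.
have [bb' pv'] : b = b' /\ positive v' = true by apply: same => //; rewrite -lt -lt'.
subst b'.
have [ev _] := tv; have [ev' _] := tv'.
have [r r0 ho] := interior_open ev (proj2 wb) b0.
have [r' r'0 ho'] := interior_open ev' (proj2 wb) b0.
have [e e0 he] := line_near (1 / 2) u t r0.
have [e' e'0 he'] := line_near (1 / 2) u (t + T) r'0.
have [g gG gv] := tile_Gamma tv'; rewrite pv' -/v in gv.
have gl s : `|s - t| < e -> `|s - t| < e' -> g (line (s + T)) = line s.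
  move=> /he + se'; rewrite {1}lt => /ho[d [wd d0 ls]].
  have : `|s + T - (t + T)| < e' by have -> : s + T - (t + T) = s - t by ring.
  move=> /he'; rewrite {1}lt' => /ho'[d' [wd' d'0 ls']].
  have [dd' _] : d = d' /\ positive v' = true by apply: same => //; rewrite -ls -ls'.
  rewrite ls ls' -dd' Gamma_barycenter ?(proj2 wd) //.
  by congr barycenter; apply/funext.
(* A second time near [t]: an affine map that undoes the shift at two distinct points of the line
   has linear part 1. *)
pose s := t + Num.min e e' / 2.
have m0 : 0 < Num.min e e' by rewrite lt_min e0.
have st : s - t = Num.min e e' / 2 by rewrite /s; ring.
have me : Num.min e e' <= e by rewrite ge_min lexx.
have me' : Num.min e e' <= e' by rewrite ge_min lexx orbT.
have gls : g (line (s + T)) = line s by apply: gl; rewrite st gtr0_norm; lra.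
have glt : g (line (t + T)) = line t by apply: gl; rewrite subrr normr0.
have [k [p [pH gE]]] := Gamma_affine gG; rewrite !gE in gls glt.
have su : (s - t)%:C * u != 0.
  rewrite mulf_neq0 ?u_neq0 // st; apply/eqP => /(congr1 (@complex.Re R)) /=; lra.
have k1 : omega ^+ (2 * k) = 1 :> R[i].
  apply: (mulIf su); rewrite mul1r.
  transitivity (p + omega ^+ (2 * k) * line (s + T) - (p + omega ^+ (2 * k) * line (t + T))).
    by rewrite !rmorphD rmorphN /=; ring.
  by rewrite gls glt rmorphB /=; ring.
rewrite k1 mul1r in glt.
have -> : T%:C * u = - p.
  transitivity (p + line (t + T) - line t - p); first by rewrite rmorphD /=; ring.
  by rewrite glt; ring.
case: pH => [x [y ->]]; exists (- x), (- y).
by rewrite !rmorphN /=; ring.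
Qed.

Definition period_length : R := if `[< Hex u >] then 1 else 3.

Lemma period_length_gt0 : 0 < period_length.
Proof. by rewrite /period_length; case: ifP. Qed.

Lemma HexMint (k : int) (z : R[i]) : Hex z -> Hex (k%:~R * z).
Proof.
by move=> [a [b ->]]; exists (k * a), (k * b); rewrite !rmorphM /=; ring.
Qed.

Lemma period_length_Hex : Hex (period_length%:C * u).
Proof.
rewrite /period_length; case: ifPn => [/asboolP h|_]; first by rewrite rmorph1 mul1r.
apply/HexP; exists (3 * m), (3 * n); split; first by exists (m - n); ring.
by rewrite /u /lat !rmorphM /= rmorphMn /=; ring.
Qed.

(** Since [T * m] and [T * n] are integers, a Bezout relation makes [T] an integer. Moreover 3
    divides [T * (m - n)], hence [T] when 3 does not divide [m - n]. *)
Lemma Hex_period_length T : 0 < T -> Hex (T%:C * u) ->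
  exists2 k : nat, (0 < k)%N & T = k%:R * period_length.
Proof.
move=> T0 /HexP[a [b [[c ab] e]]].
have Tu : T%:C * u = (T * m%:~R)%:C + (T * n%:~R)%:C * omega.
  by rewrite /u /lat !intrC !rmorphM /=; ring.
have Tm : T * m%:~R = a%:~R by have := xcoord_lat R a b; rewrite -e Tu (coordK _ _).1.
have Tn : T * n%:~R = b%:~R by have := ycoord_lat R a b; rewrite -e Tu (coordK _ _).2.
have [x [y xy]] : exists x y, x * m + y * n = 1.
  have [x [y xy]] := Bezoutz m n; exists x, y; rewrite xy.
  by move: mn_coprime; rewrite /coprimez => /eqP.
pose K := x * a + y * b.
have TK : T = K%:~R.
  rewrite /K !(rmorphD, rmorphM) /= -Tm -Tn.
  transitivity (T * (x * m + y * n)%:~R); first by rewrite xy mulr1.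
  by rewrite !(rmorphD, rmorphM) /=; ring.
have K0 : 0 < K by rewrite -(ltr_int R) -TK.
have Km : K * m = a by apply: (@intr_inj R); rewrite rmorphM /= -TK.
have Kn : K * n = b by apply: (@intr_inj R); rewrite rmorphM /= -TK.
have KR (k : int) : 0 < k -> k%:~R = (`|k|%N)%:R :> R.
  by move=> k0; rewrite -{1}(gtz0_abs k0).
rewrite /period_length; case: ifPn => [_|/asboolP nH].
  by exists `|K|%N; [lia|rewrite mulr1 -KR].
have [q mn] : exists q, m - n = 3 * q + 1 \/ m - n = 3 * q + 2.
  have : ~ exists q, m - n = 3 * q.
    by move=> [q mn]; apply: nH; apply/HexP; exists m, n; split=> //; exists q.
  have := divz_eq (m - n) 3; have := modz_ge0 (m - n) (isT : 3 != 0 :> int).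
  have := ltz_pmod (m - n) (isT : 0 < 3 :> int).
  set Q := (_ %/ _)%Z; set r := (_ %% _)%Z => r3 r0 mnE nq; exists Q.
  have : r != 0 by apply/eqP => rz; apply: nq; exists Q; rewrite mnE rz; ring.
  by lia.
have [k Kk] : exists k, K = 3 * k.
  have h : K * (m - n) = 3 * c by rewrite mulrBr Km Kn.
  case: mn => mn; rewrite mn mulrDr in h.
    exists (c - K * q); rewrite mulrBr -h; ring.
  (* Here [2 * K = 3 * (c - K * q)], and [K] is [3 * K - 2 * K]. *)
  by exists (K - (c - K * q)); rewrite !mulrBr -h; ring.
exists `|k|%N; first lia.
by rewrite TK Kk rmorphM /= mulrC KR //; lia.
Qed.

End Line.

(** * Monodromy, primitive period and length *)

Lemma within_ball (R : realType) (X : decorated_triangulation R)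
    (c : R -> surface X) (T : R) : {within `[0, T], continuous c} ->
  forall t e, 0 <= t <= T -> 0 < e ->
    exists2 d, 0 < d & forall s, 0 <= s <= T -> `|s - t| < d ->
      surface_ball (c t) e (c s).
Proof.
move=> /subspace_continuousP hc t e tT e0.
have /hc : `[0, T]%classic t by rewrite /= in_itv.
move=> /(_ _ (nbhsx_ballx (c t) e e0)) /near_ballP[d d0 hd].
by exists d => // s sT /hd; apply; rewrite /= in_itv.
Qed.

Theorem corollary7 (R : realType) (X : decorated_triangulation R)
    (f : surface X -> sphere R) (f_belyi : belyi_function f)
    (m n : int) (mn_coprime : coprimez m n) (n_odd : odd `|n|%N)
    (omega0 : R[i]) (omega0E : omega0 = m%:~R + n%:~R * omega)
    (l : R -> R[i]) (lE : forall t, l t = 1 / 2 + t%:C * omega0)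
    (tau : R) (tauE : tau = if `[< Hex omega0 >] then 1 else 3)
    (gamma : R -> sphere R) (gammaE : forall t, gamma t = projection (l t))
    (sigma : {perm dessin_edge X})
    (sigma_monodromy : monodromy f gamma tau sigma)
    (a : dessin_edge X)
    (Psi : R[i] -> surface X)
    (Psi_development : development l (midpoint a) Psi) :
  smooth_geodesic (Psi \o l) /\
  exists T : R,
    [/\ primitive_period (Psi \o l) T,
        path_length (Psi \o l) 0 T =
          ((#|porbit sigma a|%:R : R)%:E * path_length gamma 0 tau)%E,
        Hex omega0 ->
          path_length (Psi \o l) 0 T =
            (#|porbit sigma a|%:R * modulus omega0)%:E
      & ~ Hex omega0 ->
          path_length (Psi \o l) 0 T =
            (3 * #|porbit sigma a|%:R * modulus omega0)%:E].
Proof.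
set N := #|porbit sigma a|.
have u0 : omega0 != 0 by rewrite omega0E; exact: u_neq0.
have tau0 : 0 < tau by rewrite tauE omega0E; exact: period_length_gt0.
have l_fun : l = fun t => 1 / 2 + t%:C * omega0 by exact: funext.
have nl t : ~ lattice (1 / 2 + t%:C * omega0) by rewrite omega0E; exact: line_notin_lattice.
have Psi_tile := development_tilewise lE Psi_development.
have cU : unfolded_path (Psi \o l) omega0 by rewrite l_fun; exact: tilewise_unfolded.
have gU : unfolded_path gamma omega0.
  rewrite (_ : gamma = @projection R \o l); last exact: funext.
  by rewrite l_fun; apply: tilewise_unfolded => //; exact: projection_tilewise.
have fPsi t : f (Psi (l t)) = gamma t.
  have [v tv [b wb ltb]] := tile_cover (l t).
  have [|T bT PsiT] := Psi_tile v tv; first by exists t, b; rewrite // -lE.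
  by rewrite gammaE ltb PsiT // belyi_wpt // bT projection_tile.
have gamma_tau t (k : nat) : gamma (t + k%:R * tau) = gamma t.
  rewrite !gammaE !lE; subst omega0; apply: projection_period.
  rewrite rmorphM /= -mulrA rmorph_nat.
  have := HexMint k (period_length_Hex R m n).
  by rewrite /period_length -tauE.
pose c := Psi \o l.
have reg t : regular (c t) by exact: unfolded_path_regular cU.
(* r = -1 reverses the time, as [unique_lift] only goes forward. *)
have cont (r s t e : R) : `|r| = 1 -> 0 < e ->
    exists2 d, 0 < d & forall t', `|t' - t| < d ->
      surface_ball (c (s + r * t)) e (c (s + r * t')).
  move=> r1 e0; have [d d0 hd] := unfolded_path_continuous cU (s + r * t) e0.
  exists d => // t' tt'; apply: hd.
  have -> : s + r * t' - (s + r * t) = r * (t' - t) by ring.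
  by rewrite normrM r1 mul1r.
(* From time [s] on, the geodesic is a lift of one turn of [gamma], so it ends where the lift
   defining the monodromy ends. *)
have step s e : c s = midpoint e -> (forall t, gamma (s + t) = gamma t) ->
    c (s + tau) = midpoint (sigma e).
  move=> cs gs; have [c' [c'cont c'0 fc'] <-] := sigma_monodromy e.
  apply: (unique_lift (belyi_wpt f_belyi) (c := fun t => c (s + t))); first exact: ltW.
  - by rewrite addr0 c'0.
  - by move=> t tT; split=> //; rewrite fc' ?in_itv //= fPsi gs.
  - move=> g [] -> t e' tT e'0; last exact: within_ball.
    have [d d0 hd] := cont 1 s t e' (normr1 _) e'0.
    by exists d => // t' _ /hd; rewrite !mul1r.
have c_iter k : c (k%:R * tau) = midpoint (iter k sigma a).
  elim: k => [|k IH].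
    by rewrite mul0r /c /= lE mul0r addr0; case: Psi_development.
  rewrite -natr1 mulrDl mul1r; apply: step => // t.
  by rewrite addrC gamma_tau.
have N0 : 0 < N%:R :> R by rewrite ltr0n lt0n card_porbit_neq0.
pose T := N%:R * tau.
have T0 : 0 < T by rewrite mulr_gt0.
(* Both sides lift the same path and start at the same midpoint, because [sigma] iterated [N] times
   fixes [a]. *)
have shift (r t : R) : `|r| = 1 -> 0 <= t -> c (T + r * t) = c (0 + r * t).
  move=> r1 t0.
  apply: (unique_lift (belyi_wpt f_belyi) (c := fun t => c (T + r * t))
    (c' := fun t => c (0 + r * t))) => //.
  - rewrite mulr0 !addr0 c_iter iter_porbit.
    by have := c_iter 0%N; rewrite mul0r.
  - by move=> t' _; split=> //; rewrite !fPsi add0r addrC gamma_tau.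
  - move=> g [] -> t' e t'T e0.
      by have [d d0 hd] := cont r T t' e r1 e0; exists d => // x _; exact: hd.
    by have [d d0 hd] := cont r 0 t' e r1 e0; exists d => // x _; exact: hd.
have cT t : c (t + T) = c t.
  rewrite addrC; case: (leP 0 t) => t0.
    by have := shift 1 t (normr1 _) t0; rewrite mul1r add0r.
  have := shift (-1) (- t); rewrite mulrNN mul1r add0r; apply; last lra.
  by rewrite normrN1.
have lenT : path_length c 0 T = (T * modulus omega0)%:E.
  by rewrite (unfolded_path_length cU) ?ltW // subr0.
split; first exact: unfolded_path_smooth cU.
exists T; rewrite lenT; split.
- split; first by split.
  move=> T' [T'0 cT'].
  have : Hex (T'%:C * omega0).
    subst omega0; apply: period_Hex => // t.
    by rewrite -!lE -!gammaE -!fPsi; congr f; exact: cT'.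
  rewrite omega0E => /(Hex_period_length mn_coprime n_odd T'0) T'k.
  have {T'k}[k k0 T'k] : exists2 k, (0 < k)%N & T' = k%:R * tau.
    by rewrite tauE omega0E.
  rewrite T'k in cT' *.
  (* Closing up after [k] turns means that [sigma] iterated [k] times fixes [a], since the midpoint
     determines the edge. *)
  rewrite ler_pM2r // ler_nat; apply: porbit_le => //.
  apply: (@midpoint_inj R X); rewrite -c_iter.
  transitivity (c 0); first by rewrite -[k%:R * tau]add0r; exact: cT'.
  by have := c_iter 0%N; rewrite mul0r.
- by rewrite (unfolded_path_length gU) ?ltW // subr0 -EFinM mulrA.
- by move=> h; rewrite /T tauE asboolT // mulr1.
- by move=> h; rewrite /T tauE asboolF // (mulrC _ 3).
Qed.
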